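(* Let $k$ be a field, $n \ge 1$ an integer, $q=(q_{ij})$ a multiplicatively antisymmetric $n\times n$ matrix over $k^\times$, and $R = k_q[[x_1,\ldots,x_n]]$ the $q$-commutative power series ring. (i) The prime spectrum of $R$ is normally separated, and consequently $R$ satisfies the strong second layer condition. (ii) Let $G$ denote the group of $k$-algebra automorphisms of $R$ generated by the maps $r \mapsto x_i r x_i^{-1}$ for $r\in R$ and $1\le i\le n$. If $P$ and $Q$ are prime ideals of $R$ such that $P \rightsquigarrow Q$, then $\tau(P)=Q$ for some $\tau\in G$. Consequently, if $X$ is a clique in $\operatorname{Spec} R$, then $\operatorname{rank}(R/P)=\operatorname{rank}(R/P')$ for all $P,P'\in X$, where $\operatorname{rank}$ denotes Goldie rank.
   Context: Multiplicatively antisymmetric means $q_{ii}=1$ and $q_{ij}=q_{ji}^{-1}\in k^\times$ for all $i,j$. The ring $R=k_q[[x_1,\ldots,x_n]]$ is the associative unital $k$-algebra of formal skew power series $\sum_{s\in\mathbb{N}^n} c_s x^s$ ($c_s\in k$, $x^s=x_1^{s_1}\cdots x_n^{s_n}$, $\mathbb{N}$ the non-negative integers), with multiplication determined by $x_ix_j=q_{ij}x_jx_i$. It is a noetherian domain and each $x_i$ is normal ($x_iR=Rx_i$), so the $x_i$ become invertible in the Ore localization of $R$ at the multiplicative set generated by $1, x_1,\ldots,x_n$; the maps $r\mapsto x_irx_i^{-1}$, computed there, restrict to automorphisms of $R$. Normally separated: for each inclusion of prime ideals $P_0\subsetneq P_1$ of $R$ there exists $y\in P_1\setminus P_0$ such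 that $Ry+P_0=yR+P_0$. Link: for prime ideals $P,Q$ of $R$, write $P\rightsquigarrow Q$ if $(P\cap Q)/PQ$ has a nonzero $R$-$R$-bimodule factor that is torsionfree both as a left $R/P$-module and as a right $R/Q$-module. This makes $\operatorname{Spec} R$ a directed graph, whose connected components are called cliques. Strong second layer condition (as in Goodearl–Warfield): Let $R$ be noetherian. An affiliated series $0<U<M$ of a right $R$-module $M$ with corresponding affiliated primes $P,Q$ means: $P$ is maximal among annihilators of nonzero submodules of $M$ and $U=\{m\in M: mP=0\}$; $Q$ is maximal among annihilators of nonzero submodules of $M/U$ and $(M/U)Q=0$. The ring $R$ satisfies the right strong second layer condition if the following never occurs: a right $R$-module $M$ with an affiliated series $0<U<M$ and affiliated primes $P,Q$, with $U$ essential in $M$, and a submodule $M'\supsetneq U$ of $M$ whose annihilator is maximal among the annihilators of submodules of $M$ properly containing $U$, such that $Q\subsetneq P$ and $M'Q=0$. The left version is defined symmetrically; the strong second layer condition means both. *)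

(* Defs.v *)
From HB Require Import structures.
From Stdlib Require Import Relation_Operators.
From mathcomp Require Import all_boot all_algebra.
From mathcomp Require Import boolp classical_sets.
From mathcomp Require Import ring.

Set Implicit Arguments.
Unset Strict Implicit.
Unset Printing Implicit Defensive.

Import GRing.Theory.
Local Open Scope classical_set_scope.
Local Open Scope ring_scope.

Definition mult_antisym (k : fieldType) (n : nat) (q : 'M[k]_n) : Prop :=
  forall i j, [/\ q i i = 1, q i j != 0 & q i j = (q j i)^-1].

(* {ffun 'I_n -> nat} carries the pointwise addition. *)
Notation expo n := {ffun 'I_n -> nat}.

Definition delta_expo n (i : 'I_n) : expo n := [ffun j => (j == i : nat)].

(* The exponents with all entries < N, as a finite index type. *)
Notation boxed n N := {ffun 'I_n -> 'I_N}.

Definition expo_of n N (a : boxed n N) : expo n := [ffun i => a i : nat].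

Definition expo_bound n (s : expo n) : nat := (\max_(i < n) s i).+1.

Lemma expo_of_inj n N : injective (@expo_of n N).
Proof.
by move=> a b /ffunP ab; apply/ffunP => i; apply/val_inj; have := ab i; rewrite !ffunE.
Qed.

Lemma expo_boundP n (s : expo n) i : (s i < expo_bound s)%N.
Proof. by rewrite ltnS (@leq_bigmax _ (fun i => s i)). Qed.

Lemma expo_ofP n N (s : expo n) :
  (forall i, s i < N)%N -> exists a : boxed n N, expo_of a = s.
Proof.
move=> sN; exists [ffun i => Ordinal (sN i)].
by apply/ffunP => i; rewrite !ffunE.
Qed.

Lemma expo_le (n : nat) (s a b : expo n) : a + b = s ->
  (forall i, a i <= s i)%N /\ (forall i, b i <= s i)%N.
Proof.
by move=> <-; split=> i; rewrite ffunE ?leq_addr ?leq_addl.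
Qed.

Lemma addeI n : right_injective (@GRing.add (expo n)).
Proof.
move=> a b c /ffunP e; apply/ffunP => i; have := e i; rewrite !ffunE.
exact: addnI.
Qed.

Lemma addIe n : left_injective (@GRing.add (expo n)).
Proof. by move=> a b c; rewrite ![_ + a]addrC => /addeI. Qed.

Section BoxSum.
Variables (k : nmodType) (n : nat).
Implicit Types (s : expo n).

Lemma box_sum_indep (F : expo n -> expo n -> k) s N M :
  (forall i, s i < N)%N -> (forall i, s i < M)%N ->
  \sum_(a : boxed n N) \sum_(b : boxed n N | expo_of a + expo_of b == s)
     F (expo_of a) (expo_of b) =
  \sum_(a : boxed n M) \sum_(b : boxed n M | expo_of a + expo_of b == s)
     F (expo_of a) (expo_of b).
Proof.
move=> sN sM.
pose L K := [seq (expo_of p.1, expo_of p.2) | p : boxed n K * boxed n K].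
have E K : \sum_(a : boxed n K) \sum_(b : boxed n K | expo_of a + expo_of b == s)
     F (expo_of a) (expo_of b) = \sum_(p <- [seq p <- L K | p.1 + p.2 == s]) F p.1 p.2.
  rewrite pair_big_dep big_filter big_map big_enum_cond /=.
  by apply: eq_bigl.
have L_uniq K : uniq (L K).
  rewrite map_inj_uniq ?enum_uniq // => -[a b] [c d] /= [].
  by move=> /expo_of_inj -> /expo_of_inj ->.
have L_mem K p : (forall i, s i < K)%N -> p.1 + p.2 = s -> p \in L K.
  move=> sK ps; have [p1 p2] := expo_le ps.
  have [a aE] := expo_ofP (fun i => leq_ltn_trans (p1 i) (sK i)).
  have [b bE] := expo_ofP (fun i => leq_ltn_trans (p2 i) (sK i)).
  by apply/mapP; exists (a, b); rewrite ?mem_enum //= aE bE; case: (p).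
rewrite !E; apply: perm_big; apply: uniq_perm; rewrite ?filter_uniq //.
by move=> p; rewrite !mem_filter; case: eqP => //= ps; rewrite !L_mem.
Qed.

End BoxSum.

(* The series \sum_s c_s x^s is represented by the function s |-> c_s. *)
Record qpseries (k : fieldType) (n : nat) (q : 'M[k]_n) : Type :=
  QPSeries { qcoef : expo n -> k }.

Section QPSeries.
Variables (k : fieldType) (n : nat) (q : 'M[k]_n).
Local Notation R := (qpseries q).
Implicit Types (f g h : R) (s t a b c : expo n).

HB.instance Definition _ := gen_eqMixin R.
HB.instance Definition _ := gen_choiceMixin R.

Lemma qpsP f g : (forall s, qcoef f s = qcoef g s) -> f = g.
Proof.
by case: f => f; case: g => g /= fg; congr QPSeries; apply/funext.
Qed.

Definition qps_zero : R := QPSeries q (fun=> 0).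
Definition qps_opp f : R := QPSeries q (fun s => - qcoef f s).
Definition qps_add f g : R := QPSeries q (fun s => qcoef f s + qcoef g s).
Definition qps_scale (u : k) f : R := QPSeries q (fun s => u * qcoef f s).
Definition qps_monom s : R := QPSeries q (fun t => (t == s)%:R).

(* x^a x^b = qtwist a b x^(a + b): for j < i, moving x_j^(b_j) to the left of
   x_i^(a_i) produces the scalar q_ij^(a_i b_j). *)
Definition qtwist a b : k :=
  \prod_(i < n) \prod_(j < n | (j < i)%N) q i j ^+ (a i * b j).

Definition qps_mul f g : R := QPSeries q (fun s =>
  \sum_(a : boxed n (expo_bound s))
    \sum_(b : boxed n (expo_bound s) | expo_of a + expo_of b == s)
      qcoef f (expo_of a) * qcoef g (expo_of b)
      * qtwist (expo_of a) (expo_of b)).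

Lemma qtwistDl a b c : qtwist (a + b) c = qtwist a c * qtwist b c.
Proof.
rewrite -big_split; apply: eq_bigr => i _; rewrite -big_split.
by apply: eq_bigr => j _ /=; rewrite ffunE mulnDl exprD.
Qed.

Lemma qtwistDr a b c : qtwist a (b + c) = qtwist a b * qtwist a c.
Proof.
rewrite -big_split; apply: eq_bigr => i _; rewrite -big_split.
by apply: eq_bigr => j _ /=; rewrite ffunE mulnDr exprD.
Qed.

Lemma qtwist0l a : qtwist 0 a = 1.
Proof.
by rewrite /qtwist big1 // => i _; rewrite big1 // => j _; rewrite ffunE mul0n.
Qed.

Lemma qtwist0r a : qtwist a 0 = 1.
Proof.
by rewrite /qtwist big1 // => i _; rewrite big1 // => j _; rewrite ffunE muln0.
Qed.

Lemma qps_mulE N f g s : (forall i, s i < N)%N ->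
  qcoef (qps_mul f g) s =
  \sum_(a : boxed n N) \sum_(b : boxed n N)
     (qcoef f (expo_of a) * qcoef g (expo_of b)
      * qtwist (expo_of a) (expo_of b)) *+ (expo_of a + expo_of b == s).
Proof.
move=> sN.
rewrite /= (box_sum_indep (fun a b => qcoef f a * qcoef g b * qtwist a b)
  (expo_boundP s) sN).
by apply: eq_bigr => a _; rewrite big_mkcond; apply: eq_bigr => b _; case: eqP.
Qed.

Lemma box_pick N (G : expo n -> k) t : (forall i, t i < N)%N ->
  \sum_(u : boxed n N) G (expo_of u) *+ (expo_of u == t) = G t.
Proof.
move=> /expo_ofP[v <-]; rewrite (bigD1 v) //= eqxx big1 ?addr0 // => u uv.
by rewrite (inj_eq (@expo_of_inj _ _)) (negPf uv).
Qed.

Lemma qps_mulA : associative qps_mul.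
Proof.
move=> f g h; apply: qpsP => s; pose N := expo_bound s.
have sN := expo_boundP s; rewrite !(qps_mulE _ _ sN) -/N.
pose T a b c := qcoef f a * qcoef g b * qcoef h c
  * (qtwist a b * qtwist a c * qtwist b c) *+ (a + b + c == s).
transitivity (\sum_(a : boxed n N) \sum_(b : boxed n N) \sum_(c : boxed n N)
   T (expo_of a) (expo_of b) (expo_of c)).
  apply: eq_bigr => a _.
  transitivity (\sum_(u : boxed n N) \sum_(b : boxed n N) \sum_(c : boxed n N)
     T (expo_of a) (expo_of b) (expo_of c) *+ (expo_of u == expo_of b + expo_of c)).
    apply: eq_bigr => u _; have [us|us] := eqVneq (expo_of a + expo_of u) s.
      have [_ us'] := expo_le us.
      rewrite mulr1n (qps_mulE _ _ (fun i => leq_ltn_trans (us' i) (sN i))).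
      rewrite mulr_sumr mulr_suml; apply: eq_bigr => b _.
      rewrite mulr_sumr mulr_suml; apply: eq_bigr => c _.
      rewrite /T eq_sym; case: eqP => [E|]; last by rewrite !mulr0n mulr0 mul0r.
      rewrite -addrA -E us eqxx !mulr1n E qtwistDr; ring.
    rewrite mulr0n big1 // => b _; rewrite big1 // => c _.
    rewrite /T; case: (eqVneq (expo_of u)) => // E.
    by rewrite -addrA -E (negPf us).
  rewrite exchange_big; apply: eq_bigr => b _ /=.
  rewrite exchange_big; apply: eq_bigr => c _ /=.
  have [E|E] := eqVneq (expo_of a + expo_of b + expo_of c) s; last first.
    by rewrite /T (negPf E) mulr0n big1 // => u _; rewrite mul0rn.
  have [_ E'] := expo_le (etrans (addrA _ _ _) E).
  apply: (box_pick (fun=> _)) => i; exact: leq_ltn_trans (E' i) (sN i).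
symmetry; transitivity (\sum_(u : boxed n N) \sum_(c : boxed n N) \sum_(a : boxed n N)
   \sum_(b : boxed n N)
     T (expo_of a) (expo_of b) (expo_of c) *+ (expo_of u == expo_of a + expo_of b)).
  apply: eq_bigr => u _; apply: eq_bigr => c _.
  have [us|us] := eqVneq (expo_of u + expo_of c) s.
    have [us' _] := expo_le us.
    rewrite mulr1n (qps_mulE _ _ (fun i => leq_ltn_trans (us' i) (sN i))).
    rewrite !mulr_suml; apply: eq_bigr => a _.
    rewrite !mulr_suml; apply: eq_bigr => b _.
    rewrite /T eq_sym; case: eqP => [E|]; last by rewrite !mulr0n !mul0r.
    rewrite -E us eqxx !mulr1n E qtwistDl; ring.
  rewrite mulr0n big1 // => a _; rewrite big1 // => b _.
  rewrite /T; case: (eqVneq (expo_of u)) => // E.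
  by rewrite -E (negPf us).
rewrite exchange_big /=.
under eq_bigr => c _ do (rewrite exchange_big /=;
  under eq_bigr => a _ do rewrite exchange_big /=).
rewrite exchange_big; apply: eq_bigr => a _ /=.
rewrite exchange_big; apply: eq_bigr => b _ /=.
apply: eq_bigr => c _.
have [E|E] := eqVneq (expo_of a + expo_of b + expo_of c) s; last first.
  by rewrite /T (negPf E) mulr0n big1 // => u _; rewrite mul0rn.
have [E' _] := expo_le E.
apply: (box_pick (fun=> _)) => i; exact: leq_ltn_trans (E' i) (sN i).
Qed.

Lemma qcoef_monoml t f s : qcoef (qps_mul (qps_monom t) f) (t + s) =
  qcoef f s * qtwist t s.
Proof.
have sN := expo_boundP (t + s); rewrite (qps_mulE _ _ sN).
have [tl sl] := expo_le (erefl (t + s)).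
pose G a := qcoef f s * qtwist a s.
rewrite -[RHS]/(G t) -(box_pick G (fun i => leq_ltn_trans (tl i) (sN i))).
apply: eq_bigr => a _ /=; have [->|_] := eqVneq (expo_of a) t; last first.
  by rewrite big1 // => b _; rewrite !mul0r mul0rn.
pose H b := qcoef f b * qtwist t b.
rewrite mulr1n -[RHS]/(H s) -(box_pick H (fun i => leq_ltn_trans (sl i) (sN i))).
by apply: eq_bigr => b _; rewrite mul1r (inj_eq (@addeI _ _)).
Qed.

Lemma qcoef_monomr t f s : qcoef (qps_mul f (qps_monom t)) (s + t) =
  qcoef f s * qtwist s t.
Proof.
have sN := expo_boundP (s + t); rewrite (qps_mulE _ _ sN).
have [sl tl] := expo_le (erefl (s + t)).
pose G a := qcoef f a * qtwist a t.
rewrite -[RHS]/(G s) -(box_pick G (fun i => leq_ltn_trans (sl i) (sN i))).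
apply: eq_bigr => a _ /=.
rewrite /G.
rewrite -(box_pick (fun b => (qcoef f (expo_of a) * qtwist (expo_of a) b)
   *+ (expo_of a == s)) (fun i => leq_ltn_trans (tl i) (sN i))).
apply: eq_bigr => b _.
have [->|_] := eqVneq (expo_of b) t; last by rewrite mulr0 mul0r mul0rn mulr0n.
by rewrite mulr1 mulr1n (inj_eq (@addIe _ _)).
Qed.

Lemma qcoef_monoml0 t f s :
  ~~ [forall i, (t i <= s i)%N] -> qcoef (qps_mul (qps_monom t) f) s = 0.
Proof.
move=> ts; rewrite (qps_mulE _ _ (expo_boundP s)).
rewrite big1 // => a _; rewrite big1 // => b _ /=.
have [at_|_] := eqVneq; last by rewrite !mul0r mul0rn.
case: eqP => // /expo_le[E _]; case/forallP: ts => i.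
by rewrite -at_.
Qed.

Lemma qcoef_monomr0 t f s :
  ~~ [forall i, (t i <= s i)%N] -> qcoef (qps_mul f (qps_monom t)) s = 0.
Proof.
move=> ts; rewrite (qps_mulE _ _ (expo_boundP s)).
rewrite big1 // => a _; rewrite big1 // => b _ /=.
have [at_|_] := eqVneq; last by rewrite mulr0 mul0r mul0rn.
case: eqP => // /expo_le[_ E]; case/forallP: ts => i.
by rewrite -at_.
Qed.

Lemma qps_mul1r : left_id (qps_monom 0) qps_mul.
Proof.
by move=> f; apply: qpsP => s; rewrite -[s in LHS]add0r qcoef_monoml qtwist0l mulr1.
Qed.

Lemma qps_mulr1 : right_id (qps_monom 0) qps_mul.
Proof.
by move=> f; apply: qpsP => s; rewrite -[s in LHS]addr0 qcoef_monomr qtwist0r mulr1.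
Qed.

Lemma qps_mulDl : left_distributive qps_mul qps_add.
Proof.
move=> f g h; apply: qpsP => s; rewrite /= -big_split; apply: eq_bigr => a _ /=.
by rewrite -big_split; apply: eq_bigr => b _ /=; rewrite !mulrDl.
Qed.

Lemma qps_mulDr : right_distributive qps_mul qps_add.
Proof.
move=> f g h; apply: qpsP => s; rewrite /= -big_split; apply: eq_bigr => a _ /=.
by rewrite -big_split; apply: eq_bigr => b _ /=; rewrite mulrDr mulrDl.
Qed.

Lemma qps_addA : associative qps_add.
Proof. by move=> f g h; apply: qpsP => s; rewrite /= addrA. Qed.

Lemma qps_addC : commutative qps_add.
Proof. by move=> f g; apply: qpsP => s; rewrite /= addrC. Qed.

Lemma qps_add0 : left_id qps_zero qps_add.
Proof. by move=> f; apply: qpsP => s; rewrite /= add0r. Qed.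

Lemma qps_addN : left_inverse qps_zero qps_opp qps_add.
Proof. by move=> f; apply: qpsP => s; rewrite /= addNr. Qed.

HB.instance Definition _ :=
  GRing.isZmodule.Build R qps_addA qps_addC qps_add0 qps_addN.

Lemma qps_one_neq0 : qps_monom 0 != 0 :> R.
Proof.
apply/eqP => /(congr1 (fun f => qcoef f 0)) /=; rewrite eqxx => /eqP.
by rewrite oner_eq0.
Qed.

HB.instance Definition _ := GRing.Zmodule_isNzRing.Build R
  qps_mulA qps_mul1r qps_mulr1 qps_mulDl qps_mulDr qps_one_neq0.

Lemma qps_scaleA u v f : qps_scale u (qps_scale v f) = qps_scale (u * v) f.
Proof. by apply: qpsP => s; rewrite /= mulrA. Qed.

Lemma qps_scale1 : left_id 1 qps_scale.
Proof. by move=> f; apply: qpsP => s; rewrite /= mul1r. Qed.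

Lemma qps_scaleDr : right_distributive qps_scale +%R.
Proof. by move=> u f g; apply: qpsP => s; rewrite /= mulrDr. Qed.

Lemma qps_scaleDl f : {morph qps_scale^~ f : u v / u + v}.
Proof. by move=> u v; apply: qpsP => s; rewrite /= mulrDl. Qed.

HB.instance Definition _ := GRing.Zmodule_isLmodule.Build k R
  qps_scaleA qps_scale1 qps_scaleDr qps_scaleDl.

Lemma qps_scaleAl (u : k) f g : u *: (f * g) = (u *: f) * g.
Proof.
apply: qpsP => s; rewrite /= mulr_sumr; apply: eq_bigr => a _.
by rewrite mulr_sumr; apply: eq_bigr => b _; rewrite !mulrA.
Qed.

HB.instance Definition _ := GRing.Lmodule_isLalgebra.Build k R qps_scaleAl.

Lemma qps_scaleAr (u : k) f g : u *: (f * g) = f * (u *: g).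
Proof.
apply: qpsP => s; rewrite /= mulr_sumr; apply: eq_bigr => a _.
by rewrite mulr_sumr; apply: eq_bigr => b _; rewrite /= !mulrA [u * _]mulrC.
Qed.

HB.instance Definition _ := GRing.Lalgebra_isAlgebra.Build k R qps_scaleAr.

Definition qvar (i : 'I_n) : R := qps_monom (delta_expo i).

Lemma qps_monomM a b : qps_monom a * qps_monom b =
  qtwist a b *: qps_monom (a + b).
Proof.
apply: qpsP => s.
case: (boolP [forall i, (a i <= s i)%N]) => [/forallP as_|as_].
  have -> : s = a + [ffun i => s i - a i]%N.
    by apply/ffunP => i; rewrite !ffunE /= -[LHS](subnKC (as_ i)).
  rewrite qcoef_monoml /= (inj_eq (@addeI _ _)) mulrC.
  by case: eqP => [->|]; rewrite ?mulr0.
rewrite qcoef_monoml0 //=; case: eqP => [E|]; rewrite ?mulr0 //.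
by case/forallP: as_ => i; rewrite E ffunE leq_addr.
Qed.

Lemma qtwist_delta i j :
  qtwist (delta_expo i) (delta_expo j) = if (j < i)%N then q i j else 1.
Proof.
rewrite /qtwist (bigD1 i) //= [X in _ * X]big1 ?mulr1; last first.
  by move=> l li; rewrite big1 // => m _; rewrite ffunE (negPf li) mul0n.
case: ifP => ji.
  rewrite (bigD1 j) //= !ffunE !eqxx big1 ?mulr1 // => m /andP[_ mj].
  by rewrite !ffunE (negPf mj) muln0.
rewrite big1 // => m mi; rewrite !ffunE eqxx; case: eqP => [E|]; rewrite ?muln0 //.
by rewrite -E mi in ji.
Qed.

Lemma qvarC : mult_antisym q ->
  forall i j, qvar i * qvar j = q i j *: (qvar j * qvar i).
Proof.
move=> hq i j; rewrite !qps_monomM !qtwist_delta [delta_expo j + _]addrC.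
rewrite scalerA; congr (_ *: _); have [_ qn0 qV] := hq i j.
have [ij|ji|/val_inj<-] := ltngtP i j.
- by rewrite qV mulVf //; have [] := hq j i.
- by rewrite mulr1.
- by rewrite mulr1; have [->] := hq i i.
Qed.

Lemma qvarX i m : qvar i ^+ m = qps_monom (delta_expo i *+ m).
Proof.
elim: m => [|m IH]; first by rewrite expr0.
rewrite exprS IH qps_monomM mulrS; suff -> : qtwist (delta_expo i) (delta_expo i *+ m) = 1.
  by rewrite scale1r.
elim: m {IH} => [|m IH]; first exact: qtwist0r.
by rewrite mulrS qtwistDr IH qtwist_delta ltnn mulr1.
Qed.

Lemma qps_monomE s : qps_monom s = \prod_(i < n) qvar i ^+ s i.
Proof.
have H m : (m <= n)%N -> \prod_(i < n | (i < m)%N) qvar i ^+ s i =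
    qps_monom [ffun i : 'I_n => if (i < m)%N then s i else 0%N].
  elim: m => [|m IH] mn.
    by rewrite big_pred0 //; congr qps_monom; apply/ffunP => i; rewrite !ffunE.
  pose F (l : nat) : R := if insub l is Some i then qvar i ^+ s i else 1.
  have FE (i : 'I_n) : F i = qvar i ^+ s i by rewrite /F valK.
  have E l : (l <= n)%N ->
      \prod_(i < n | (i < l)%N) qvar i ^+ s i = \prod_(i < l) F i.
    move=> ln; rewrite (big_ord_widen_cond n xpredT F ln).
    by apply: eq_big => // i _; rewrite FE.
  rewrite E // big_ord_recr /= -E ?(ltnW mn) // IH ?(ltnW mn) //.
  rewrite -[F m]/(F (Ordinal mn)) FE qvarX qps_monomM.
  set a := finfun _; suff -> : qtwist a (delta_expo (Ordinal mn) *+ s (Ordinal mn)) = 1.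
    rewrite scale1r; congr qps_monom; apply/ffunP => i; rewrite !ffunE.
    have -> : (delta_expo (Ordinal mn) *+ s (Ordinal mn)) i
        = ((i == Ordinal mn) * s (Ordinal mn))%N.
      elim: (s _) => [|c IHc]; first by rewrite ffunE muln0.
      by rewrite mulrS ffunE IHc ffunE mulnS.
    rewrite ltnS [(i <= m)%N]leq_eqVlt; have [->|im] := eqVneq i (Ordinal mn).
      by rewrite /= ltnn eqxx /= mul1n.
    rewrite -[(i : nat) == m]/(i == Ordinal mn) (negPf im) /= mul0n.
    exact: addn0.
  elim: (s _) => [|c IHc]; first exact: qtwist0r.
  rewrite mulrS qtwistDr IHc mulr1 /qtwist big1 // => i _; rewrite big1 // => j ji.
  rewrite !ffunE; case: ltnP => im; rewrite ?mul0n //.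
  case: eqP => [E'|]; rewrite ?muln0 //.
  by have := ltn_trans ji im; rewrite E' /= ltnn.
have := H n (leqnn n).
have -> : [ffun i : 'I_n => if (i < n)%N then s i else 0%N] = s.
  by apply/ffunP => i; rewrite ffunE ltn_ord.
by move<-; apply: eq_bigl => i; rewrite ltn_ord.
Qed.

End QPSeries.

Section Conjugation.
Variables (k : fieldType) (n : nat) (q : 'M[k]_n).
Local Notation R := (qpseries q).
Local Notation x := (qvar q).

(* t is the map r |-> x_i r x_i^-1, with the denominator cleared;
   see is_xconj_frac, is_xconj_ex and is_xconj_unique below. *)
Definition is_xconj (i : 'I_n) (t : R -> R) : Prop :=
  forall r, t r * x i = x i * r.

Inductive qconj_group : (R -> R) -> Prop :=
| QConj_gen i t of is_xconj i t : qconj_group t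
| QConj_id : qconj_group id
| QConj_comp t u of qconj_group t & qconj_group u : qconj_group (t \o u)
| QConj_inv t u of qconj_group t & cancel t u & cancel u t : qconj_group u.

Lemma is_xconj_frac (S : unitRingType) (phi : {rmorphism R -> S}) i t :
  injective phi -> phi (x i) \is a GRing.unit ->
  (forall r, phi (t r) = phi (x i) * phi r * (phi (x i))^-1) <-> is_xconj i t.
Proof.
move=> phi_inj xu; split=> h r.
  by apply: phi_inj; rewrite !rmorphM /= h divrK.
by rewrite -rmorphM -h rmorphM mulrK.
Qed.

Hypothesis hq : mult_antisym q.

Lemma qtwist_neq0 a b : qtwist q a b != 0.
Proof.
rewrite prodf_seq_neq0; apply/allP => i _ /=.
rewrite prodf_seq_neq0; apply/allP => j _; apply/implyP => _.
by rewrite expf_neq0 //; have [] := hq i j.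
Qed.

Lemma mulx_inj i : injective (fun r => x i * r).
Proof.
move=> r s e; apply: qpsP => a.
have := congr1 (fun f => qcoef f (delta_expo i + a)) e.
by rewrite !qcoef_monoml => /mulIf; apply; exact: qtwist_neq0.
Qed.

Lemma xmul_inj i : injective (fun r => r * x i).
Proof.
move=> r s e; apply: qpsP => a.
have := congr1 (fun f => qcoef f (a + delta_expo i)) e.
by rewrite !qcoef_monomr => /mulIf; apply; exact: qtwist_neq0.
Qed.

Definition xscale (c : expo n -> k) (r : R) : R :=
  QPSeries q (fun s => qcoef r s * c s).

Definition xchar i (s : expo n) : k :=
  qtwist q (delta_expo i) s / qtwist q s (delta_expo i).

Lemma xscaleP i : is_xconj i (xscale (xchar i)).
Proof.
move=> r; apply: qpsP => s.
case: (boolP [forall j, (delta_expo i j <= s j)%N]) => [/forallP h|h].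
  have -> : s = [ffun j => s j - delta_expo i j]%N + delta_expo i.
    by apply/ffunP => j; rewrite [RHS]ffunE ffunE -[LHS](subnK (h j)).
  rewrite qcoef_monomr addrC qcoef_monoml /= /xchar -!mulrA; congr (_ * _).
  by rewrite mulVf ?mulr1 // qtwist_neq0.
by rewrite qcoef_monomr0 ?qcoef_monoml0.
Qed.

Lemma is_xconj_ex i : exists t, is_xconj i t.
Proof. by exists (xscale (xchar i)); exact: xscaleP. Qed.

Lemma is_xconj_unique i t u : is_xconj i t -> is_xconj i u -> t = u.
Proof. by move=> ht hu; apply/funext => r; apply: (@xmul_inj i); rewrite /= ht hu. Qed.

Lemma is_xconj_bij i t : is_xconj i t -> bijective t.
Proof.
move/is_xconj_unique/(_ (xscaleP i)) => ->.
have nz s : xchar i s != 0 by rewrite mulf_neq0 ?invr_eq0 ?qtwist_neq0.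
exists (xscale (fun s => (xchar i s)^-1)) => r; apply: qpsP => s /=.
  by rewrite mulfK.
by rewrite mulfVK.
Qed.

Lemma qconj_group_aut t : qconj_group t ->
  [/\ linear t, monoid_morphism t & bijective t].
Proof.
elim=> {t} [i t ht||t u _ [lt [t1 tM] bt] _ [lu [u1 uM] bu]
           |t u _ [lt [t1 tM] bt] tK uK].
- split; last exact: is_xconj_bij ht.
  + move=> a r s; apply: (@xmul_inj i).
    by rewrite /= mulrDl -scalerAl !ht mulrDr scalerAr.
  + split=> [|r s]; apply: (@xmul_inj i); first by rewrite /= ht mulr1 mul1r.
    by rewrite /= ht -mulrA ht !mulrA ht.
- by split=> //; exists id.
- split; last exact: bij_comp.
  + by move=> a r s; rewrite /= lu lt.
  + by split=> [|r s] /=; rewrite ?u1 ?t1 ?uM ?tM.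
- split; last by exists t.
  + by move=> a r s; apply: (can_inj tK); rewrite uK lt !uK.
  + split=> [|r s]; first by rewrite -t1 tK.
    by rewrite -[LHS]/(u (r * s)) -{1}(uK r) -{1}(uK s) -tM tK.
Qed.

End Conjugation.

Section Ideals.
Variable A : nzRingType.
Implicit Types (I J P Q : set A).

Definition right_ideal I : Prop :=
  [/\ I 0, forall a b, I a -> I b -> I (a + b) & forall a r, I a -> I (a * r)].

Definition ideal I : Prop :=
  right_ideal I /\ forall r a, I a -> I (r * a).

Definition ideal_mul I J : set A :=
  [set r | exists2 s : seq (A * A),
     (forall p, p \in s -> I p.1 /\ J p.2) & r = \sum_(p <- s) p.1 * p.2].

Definition prime_ideal P : Prop :=
  [/\ ideal P, P <> setT &
      forall I J, ideal I -> ideal J -> ideal_mul I J `<=` P ->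
        I `<=` P \/ J `<=` P].

Record Spec : Type := MkSpec { spec_ideal :> set A; spec_prime : prime_ideal spec_ideal }.

Definition normally_separated : Prop :=
  forall P0 P1 : Spec, P0 `<` P1 ->
    exists2 y, (P1 `\` P0) y &
      [set r * y + p | r in setT & p in P0] = [set y * r + p | r in setT & p in P0].

Definition regular_mod P (c : A) : Prop :=
  forall r, (P (c * r) -> P r) /\ (P (r * c) -> P r).

(* The nonzero bimodule factors of (P \cap Q)/PQ are the (P \cap Q)/J for the
   ideals J with PQ <= J < P \cap Q. *)
Definition link P Q : Prop :=
  exists J, [/\ ideal J, ideal_mul P Q `<=` J, J `<` P `&` Q,
    forall c m, regular_mod P c -> (P `&` Q) m -> J (c * m) -> J m &
    forall c m, regular_mod Q c -> (P `&` Q) m -> J (m * c) -> J m].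

Definition clique (X : set Spec) : Prop :=
  exists P : Spec,
    X = [set Q : Spec | clos_refl_sym_trans Spec (fun P1 P2 : Spec => link P1 P2) P Q].

(* A/P contains a direct sum of d nonzero right ideals; the right ideals of A/P
   are the I/P for the right ideals I of A containing P. *)
Definition indep_right_ideals P (d : nat) : Prop :=
  exists I : 'I_d -> set A,
    (forall i, right_ideal (I i) /\ P `<` I i) /\
    (forall a : 'I_d -> A, (forall i, I i (a i)) ->
       P (\sum_i a i) -> forall i, P (a i)).

(* d is the (right) Goldie rank of A/P, i.e. the uniform dimension of the right
   module A/P. *)
Definition goldie_rank P (d : nat) : Prop :=
  indep_right_ideals P d /\ forall e, indep_right_ideals P e -> (e <= d)%N.

End Ideals.

Section SecondLayer.
Variables (A : nzRingType) (M : lmodType A).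
Implicit Types (N U : set M) (P Q : set A).

Definition submodule N : Prop :=
  [/\ N 0, forall m m', N m -> N m' -> N (m + m') & forall r m, N m -> N (r *: m)].

(* The annihilator of N/U, for submodules U <= N of M. *)
Definition annihilator N U : set A := [set r | forall m, N m -> U (r *: m)].

(* P is maximal among the annihilators of the nonzero submodules N/U of M/U. *)
Definition max_annihilator U P : Prop :=
  (exists N, [/\ submodule N, U `<` N & P = annihilator N U]) /\
  (forall N, submodule N -> U `<` N -> P `<=` annihilator N U ->
     P = annihilator N U).

Definition affiliated U P Q : Prop :=
  [/\ [/\ submodule U, [set 0] `<` U & U `<` setT],
      max_annihilator [set 0] P, U = [set m | forall r, P r -> r *: m = 0],
      max_annihilator U Q & forall r m, Q r -> U (r *: m)].

Definition essential U : Prop :=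
  forall N, submodule N -> [set 0] `<` N -> [set 0] `<` N `&` U.

Definition second_layer_obstruction : Prop :=
  exists U M' P Q,
    [/\ affiliated U P Q, essential U,
        [/\ submodule M', U `<` M' &
            forall N, submodule N -> U `<` N ->
              annihilator M' [set 0] `<=` annihilator N [set 0] ->
              annihilator M' [set 0] = annihilator N [set 0]],
        Q `<` P & forall r m, Q r -> M' m -> r *: m = 0].

End SecondLayer.

Definition left_strong_second_layer (A : nzRingType) : Prop :=
  forall M : lmodType A, ~ second_layer_obstruction M.

(* Right A-modules are left modules over the converse ring A^c, with r *: m
   standing for m r. *)
Definition right_strong_second_layer (A : nzRingType) : Prop :=
  left_strong_second_layer A^c.

Definition strong_second_layer (A : nzRingType) : Prop :=
  right_strong_second_layer A /\ left_strong_second_layer A.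

(* Main.v *)
(**
  Division by leading terms for the degree-lexicographic order, with Dickson's
  lemma, shows that R is noetherian on both sides and that its one-sided ideals
  are closed.

  Let S be the set of the a with x^a outside a prime P. The maps
  r |-> x^a r x^-a, for a in S, preserve P and rescale the monomials; sorting the
  monomials of f by their eigenvalues writes f as an infinite sum of isotypic
  parts, and since ideals are closed an ideal stable under these maps contains f
  iff it contains all its parts. An isotypic part commutes up to scalars with the
  x^a for a in S, so it is normal modulo P. Applied to the
  saturation of an ideal I by these x^a, this shows that if I is not contained in P,
  then I has an element outside P that is normal modulo P. The second layer condition
  follows by Fitting's argument.

  If P ~> Q through (P cap Q)/J, then an element normal modulo J lies in P iff it
  lies in Q. Either some x^a in P is outside J, and then its left and right
  annihilators modulo J are P and Q, so that conjugation by x^a maps Q to P; or the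
  isotypic parts of the elements of P and Q are normal modulo J, and P = Q.
*)

From HB Require Import structures.
From Stdlib Require Import Relation_Operators.
Require Import Defs.
From mathcomp Require Import all_boot all_order all_algebra.
From mathcomp Require Import boolp classical_sets.
From mathcomp Require Import ring.

Set Implicit Arguments.
Unset Strict Implicit.
Unset Printing Implicit Defensive.

Import Order.TTheory GRing.Theory.
Local Open Scope classical_set_scope.
Local Open Scope ring_scope.

(** * The degree-lexicographic order and Dickson's lemma *)

Section MonomialOrder.
Variable n : nat.
Implicit Types (s t u a b : expo n).

Definition expo_deg s : nat := (\sum_(i < n) s i)%N.

(** Putting the total degree first leaves only finitely many exponents below a given one; [rk]
    counts them. *)
Definition deglex_key s : seqlexi nat :=
  expo_deg s :: [seq s i | i <- enum 'I_n].

Lemma expo_degD s t : expo_deg (s + t) = (expo_deg s + expo_deg t)%N.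
Proof. by rewrite /expo_deg -big_split; apply: eq_bigr => i _; rewrite ffunE. Qed.

Lemma deglex_key_inj : injective deglex_key.
Proof.
move=> s t [_ /eq_in_map e]; apply/ffunP => i.
by apply: e; rewrite mem_enum.
Qed.

Lemma deglex_key_ltD s t u :
  (deglex_key (s + u) < deglex_key (t + u))%O = (deglex_key s < deglex_key t)%O.
Proof.
rewrite /deglex_key /= !ltxi_cons !expo_degD !leEnat !leq_add2r.
congr (_ && (_ ==> _)); elim: (enum _) => //= i r IH.
by rewrite !ltxi_cons IH !ffunE !leEnat !leq_add2r.
Qed.

Lemma deglex_deg s t : (deglex_key s < deglex_key t)%O -> (expo_deg s <= expo_deg t)%N.
Proof. by rewrite ltxi_cons => /andP[]. Qed.

(** A smaller exponent has degree at most that of [s], so its entries fit in the box of side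
    [(expo_deg s).+1]. *)
Definition below s : seq (expo n) :=
  [seq t <- [seq expo_of a | a : boxed n (expo_deg s).+1] | (deglex_key t < deglex_key s)%O].

Lemma below_uniq s : uniq (below s).
Proof. by rewrite filter_uniq // map_inj_uniq ?enum_uniq //; exact: expo_of_inj. Qed.

Lemma mem_below s t : (t \in below s) = (deglex_key t < deglex_key s)%O.
Proof.
rewrite mem_filter; case ts: (_ < _)%O => //=.
have [i|a <-] := @expo_ofP n (expo_deg s).+1 t; last by rewrite map_f ?mem_enum.
rewrite ltnS (leq_trans _ (deglex_deg ts)) //.
by rewrite /expo_deg (bigD1 i) //= leq_addr.
Qed.

Definition rk s : nat := size (below s).

Lemma rk_lt_key s t : (deglex_key s < deglex_key t)%O -> (rk s < rk t)%N.
Proof.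
move=> st; apply: (@uniq_leq_size _ (s :: below s)).
  by rewrite /= below_uniq mem_below ltxx.
move=> u; rewrite inE mem_below => /orP[/eqP->|us]; rewrite mem_below //.
exact: lt_trans st.
Qed.

Lemma rk_lt s t : (rk s < rk t)%N = (deglex_key s < deglex_key t)%O.
Proof.
case: (ltgtP (deglex_key s) (deglex_key t)) => [/rk_lt_key//|/rk_lt_key|].
  by move/ltnW; rewrite leqNgt => /negPf.
by move/deglex_key_inj->; rewrite ltnn.
Qed.

Lemma rk_inj : injective rk.
Proof.
move=> s t e; apply: deglex_key_inj.
by case: (ltgtP (deglex_key s) (deglex_key t)) => // /rk_lt_key; rewrite e ltnn.
Qed.

Lemma rk_ltD s t u : (rk (s + u)%R < rk (t + u)%R)%N = (rk s < rk t)%N.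
Proof. by rewrite !rk_lt deglex_key_ltD. Qed.

Lemma rk_leD s t u : (rk (s + u)%R <= rk (t + u)%R)%N = (rk s <= rk t)%N.
Proof. by rewrite leqNgt rk_ltD -leqNgt. Qed.

Lemma rk_initial_finite N : exists l : seq (expo n), forall s, (rk s < N)%N -> s \in l.
Proof.
elim: N => [|N [l lP]]; first by exists [::].
have [[s sN]|nos] := pselect (exists s, rk s = N); last first.
  exists l => s; rewrite ltnS leq_eqVlt => /orP[/eqP sN|/lP//].
  by case: nos; exists s.
exists (s :: l) => t; rewrite ltnS leq_eqVlt inE => /orP[/eqP|/lP->]; last by rewrite orbT.
by rewrite -sN => /rk_inj->; rewrite eqxx.
Qed.

Definition expo_dvd s t : bool := [forall i, (s i <= t i)%N].

Lemma expo_dvdP s t : reflect (exists u, t = s + u) (expo_dvd s t).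
Proof.
apply: (iffP forallP) => [st|[u ->] i]; last by rewrite ffunE leq_addr.
exists [ffun i => t i - s i]%N; apply/ffunP => i.
by rewrite !ffunE -[LHS](subnKC (st i)).
Qed.

(** Each index is chosen where [v] attains its minimum over the tail that follows the previous
    index. *)
Lemma nondecreasing_subseq (v : nat -> nat) : exists phi : nat -> nat,
  (forall i j, (i < j)%N -> (phi i < phi j)%N) /\
  (forall i j, (i < j)%N -> (v (phi i) <= v (phi j))%N).
Proof.
have tail_min N : exists m, (N <= m)%N /\ forall j, (N <= j)%N -> (v m <= v j)%N.
  pose p c := `[< exists m, (N <= m)%N /\ v m = c >].
  have [|c /asboolP[m [Nm vm]] cmin] := @ex_minnP p.
    by exists (v N); apply/asboolP; exists N.
  by exists m; split=> // j Nj; rewrite vm cmin //; apply/asboolP; exists j.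
have [mu muP] := choice tail_min.
pose phi := fix phi i := if i is i'.+1 then mu (phi i').+1 else mu 0%N.
have phiS i : (phi i < phi i.+1)%N by have [] := muP (phi i).+1.
have phi_lt i j : (i < j)%N -> (phi i < phi j)%N.
  exact: (homo_ltn ltn_trans).
exists phi; split=> // i j /phi_lt ij; case: i ij => [|i] ij.
  by have [_ ->] := muP 0%N.
have [_ -> //] := muP (phi i).+1.
exact: ltn_trans ij.
Qed.

(** Subsequences are refined one coordinate after another, until they are nondecreasing in all of
    them. *)
Lemma expo_wqo (u : nat -> expo n) :
  exists i j, (i < j)%N /\ expo_dvd (u i) (u j).
Proof.
suff /(_ n)[phi [phi_lt phi_le]] : forall m, exists phi : nat -> nat,
    (forall i j, (i < j)%N -> (phi i < phi j)%N) /\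
    (forall i j, (i < j)%N -> forall l : 'I_n, (l < m)%N -> (u (phi i) l <= u (phi j) l)%N).
  exists (phi 0%N), (phi 1%N); split; first exact: phi_lt.
  by apply/forallP => l; apply: phi_le.
elim=> [|m [phi [phi_lt phi_le]]]; first by exists id.
have [mn|nm] := ltnP m n; last first.
  exists phi; split=> // i j ij l _; apply: phi_le => //.
  exact: leq_trans (ltn_ord l) nm.
have [psi [psi_lt psi_le]] := nondecreasing_subseq (fun i => u (phi i) (Ordinal mn)).
exists (phi \o psi); split=> [i j ij|i j ij l]; first exact/phi_lt/psi_lt.
rewrite ltnS leq_eqVlt => /orP[/eqP lm|]; last exact/phi_le/psi_lt.
have -> : l = Ordinal mn by apply: val_inj.
exact: psi_le.
Qed.

(** Otherwise elements of [S] could be picked one after another, none divisible by an earlier one,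
    against [expo_wqo]. *)
Lemma dickson (S : set (expo n)) : exists B : seq (expo n),
  (forall b, b \in B -> S b) /\ forall s, S s -> exists2 b, b \in B & expo_dvd b s.
Proof.
apply: contrapT => nB.
(* The premise on [B] sits under the existential, with default 0, so that [choice] applies to all
   sequences. *)
have pick (B : seq (expo n)) : exists s, (forall b, b \in B -> S b) ->
    S s /\ forall b, b \in B -> ~~ expo_dvd b s.
  have [BS|] := pselect (forall b, b \in B -> S b); last by exists 0.
  apply: contrapT => H; apply: nB; exists B; split=> // s Ss.
  apply: contrapT => Hs; apply: H; exists s => _; split=> // b bB.
  by apply/negP => bs; apply: Hs; exists b.
have [f fP] := choice pick.
pose L := fix L i := if i is i'.+1 then f (L i') :: L i' else [::].
have LS i : forall b, b \in L i -> S b.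
  elim: i => //= i IH b; rewrite inE => /orP[/eqP->|/IH//].
  by have [] := fP _ IH.
have Lmem i j : (i < j)%N -> f (L i) \in L j.
  elim: j => // j IH; rewrite ltnS leq_eqVlt /= inE => /orP[/eqP->|/IH->].
    by rewrite eqxx.
  by rewrite orbT.
have [i [j [ij]]] := expo_wqo (fun i => f (L i)).
by apply/negP; have [_] := fP _ (LS j); apply; apply: Lmem.
Qed.

End MonomialOrder.

(** * Division by leading terms *)

Section Division.
Variables (k : fieldType) (n : nat) (q : 'M[k]_n).
Local Notation R := (qpseries q).
Implicit Types (f g h r : R) (s t u a b e : expo n) (N : nat) (I : set R).

Definition vanish_below N f : Prop := forall s, (rk s < N)%N -> qcoef f s = 0.

(** Since initial segments of the order are finite, this is closedness for coefficientwise
    convergence. *)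
Definition adic_closed I : Prop :=
  forall f, (forall N, exists2 g, I g & vanish_below N (f - g)) -> I f.

Lemma qcoef_sum (T : eqType) (l : seq T) (F : T -> R) s :
  qcoef (\sum_(i <- l) F i) s = \sum_(i <- l) qcoef (F i) s.
Proof. by elim: l => [|i l IH]; rewrite ?big_nil ?big_cons //= IH. Qed.

Lemma qcoefD f g s : qcoef (f + g) s = qcoef f s + qcoef g s. Proof. by []. Qed.
Lemma qcoefB f g s : qcoef (f - g) s = qcoef f s - qcoef g s. Proof. by []. Qed.
Lemma qcoefZ (c : k) f s : qcoef (c *: f) s = c * qcoef f s. Proof. by []. Qed.

Section OneSided.
(* [op] stands for the multiplication of [R] or of its converse, so that left
   and right ideals are treated together. *)
Variables (op : R -> R -> R) (w : expo n -> expo n -> k).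
Hypothesis opD : forall f, {morph op f : g h / g + h}.
Hypothesis opZ : forall f (c : k) g, op f (c *: g) = c *: op f g.
Hypothesis op_supp : forall f g s,
  (forall a b, a + b = s -> qcoef f a = 0 \/ qcoef g b = 0) -> qcoef (op f g) s = 0.
Hypothesis op_monom : forall f s t,
  qcoef (op f (qps_monom q t)) (s + t) = qcoef f s * w s t.
Hypothesis w_neq0 : forall s t, w s t != 0.

Variable I : set R.
Hypotheses (I0 : I 0) (ID : forall f g, I f -> I g -> I (f + g)).
Hypotheses (IN : forall f, I f -> I (- f)) (IM : forall f g, I f -> I (op f g)).

(** As usual for power series, the leading exponent is the lowest one. *)
Definition lead_expo e : Prop :=
  exists f, [/\ I f, qcoef f e != 0 & vanish_below (rk e) f].

Section Reduction.
Variables (B : seq (expo n)) (g : expo n -> R) (d : expo n -> expo n * expo n).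
Variable f : R.
Hypothesis B_uniq : uniq B.
Hypothesis gP : forall b, b \in B ->
  [/\ I (g b), qcoef (g b) b != 0 & vanish_below (rk b) (g b)].
Hypothesis dP : forall e, lead_expo e -> (d e).1 \in B /\ e = (d e).1 + (d e).2.

Definition cancel_coef e r : k :=
  qcoef r e / (qcoef (g (d e).1) (d e).1 * w (d e).1 (d e).2).

Definition expo_at N : option (expo n) :=
  if pselect (exists s, rk s = N) is left ex then Some (projT1 (cid ex)) else None.

(** Exponents are treated by increasing rank. Under [gP] and [dP], what is subtracted at stage [M]
    vanishes below rank [M], so coefficients already treated stay fixed. *)
Fixpoint remainder N : R :=
  if N is M.+1 then
    let r := remainder M in
    if expo_at M is Some e then
      if `[< lead_expo e >] then
        r - op (g (d e).1) (cancel_coef e r *: qps_monom q (d e).2)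
      else r
    else r
  else f.

(** The factor used when the exponent [b + u] is reached, provided that [d] assigns it to the
    divisor [b]; a leading exponent thus contributes to a single quotient. *)
Definition quotient_coef b u : k :=
  if `[< lead_expo (b + u) /\ (d (b + u)).1 = b >]
  then cancel_coef (b + u) (remainder (rk (b + u))) else 0.

Definition quotient b : R := QPSeries q (quotient_coef b).

Definition quotient_trunc N b : R :=
  QPSeries q (fun u => if (rk (b + u)%R < N)%N then quotient_coef b u else 0).

(** Stage [N] changes at most one truncated quotient, and that one in a single coefficient. *)
Lemma remainderE N :
  remainder N = f - \sum_(b <- B) op (g b) (quotient_trunc N b).
Proof.
elim: N => [|N IH].
  rewrite big1 ?subr0 // => b _; apply: qpsP => s.
  by apply: op_supp => a u _; right.
have same : (forall e, rk e = N -> ~ lead_expo e) -> forall b,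
    quotient_trunc N.+1 b = quotient_trunc N b.
  move=> H b; apply: qpsP => u /=; rewrite ltnS.
  case: ltngtP => // bu; rewrite /quotient_coef.
  by case: asboolP => // -[/H].
rewrite /= /expo_at; case: pselect => [ex|nex]; last first.
  rewrite IH; congr (_ - _); apply: eq_bigr => b _; rewrite same // => e eN.
  by case: nex; exists e.
case: (cid ex) => e /= eN; case: asboolP => [le|nle]; last first.
  rewrite IH; congr (_ - _); apply: eq_bigr => b _; rewrite same // => e' e'N.
  by rewrite (rk_inj (etrans e'N (esym eN))).
have [dB eE] := dP le; set b0 := (d e).1 in dB eE *; set u0 := (d e).2 in eE *.
rewrite [in X in X - _]IH !(bigD1_seq b0) //= -!addrA -!opprD; congr (_ - _).
rewrite addrAC -opD; congr (op _ _ + _).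
  apply: qpsP => u /=; rewrite ltnS [in RHS]leq_eqVlt.
  have [->|uu0] := eqVneq u u0.
    rewrite -eE eN eqxx ltnn add0r mulr1 /= /quotient_coef -eE eN.
    by case: asboolP => // -[].
  rewrite mulr0 addr0; case: eqP => // buN.
  have : b0 + u = b0 + u0 by rewrite -eE; apply: rk_inj; rewrite eN.
  by move/addeI/eqP; rewrite (negPf uu0).
rewrite big_seq_cond [RHS]big_seq_cond.
apply: eq_bigr => b /andP[bB bb0]; congr (op _ _); apply: qpsP => u /=.
rewrite ltnS; case: ltngtP => // buN; rewrite /quotient_coef.
case: asboolP => // -[_]; rewrite (rk_inj (etrans buN (esym eN))) => b0E.
by rewrite -b0E eqxx in bb0.
Qed.

(** The part of a quotient beyond its truncation only contributes at rank [N] or more, because [g b]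
    vanishes below the rank of [b]. *)
Lemma remainder_limit N e : (rk e < N)%N ->
  qcoef (f - \sum_(b <- B) op (g b) (quotient b)) e = qcoef (remainder N) e.
Proof.
move=> eN; rewrite remainderE !qcoefB !qcoef_sum; congr (_ - _).
rewrite big_seq [RHS]big_seq; apply: eq_bigr => b bB.
rewrite -[quotient b](subrK (quotient_trunc N b)) opD qcoefD.
rewrite op_supp ?add0r // => a u aue.
have [ab|ba] := ltnP (rk a) (rk b); first by left; have [_ _ ->] := gP bB.
right=> /=; rewrite (leq_ltn_trans _ eN) ?subrr //.
by rewrite -aue rk_leD.
Qed.

Lemma remainder_lead e : lead_expo e ->
  qcoef (f - \sum_(b <- B) op (g b) (quotient b)) e = 0.
Proof.
move=> le; rewrite (remainder_limit (ltnSn (rk e))) /= /expo_at.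
case: pselect => [ex|[]]; last by exists e.
case: (cid ex) => e' /= /rk_inj ->; case: asboolP => // _.
have [dB eE] := dP le; rewrite qcoefB opZ qcoefZ [X in qcoef (op _ _) X]eE op_monom.
have [_ gn0 _] := gP dB.
by rewrite /cancel_coef divfK ?subrr // mulf_neq0.
Qed.

End Reduction.

(** Taking [f] in the closure of [I] yields finite generation and closedness at once. The lowest
    exponent of a nonzero remainder would be a leading exponent of [I], since [f] is approximated
    beyond it by an element of [I]; but [remainder_lead] makes that coefficient 0. *)
Lemma one_sided_basis : exists (B : seq (expo n)) (g : expo n -> R),
  (forall b, b \in B -> I (g b)) /\
  forall f, (forall N, exists2 f', I f' & vanish_below N (f - f')) ->
    exists h : expo n -> R, f = \sum_(b <- B) op (g b) (h b).
Proof.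
have [B0 [B0S B0d]] := dickson lead_expo.
pose B := undup B0.
have g_ex b : exists g, lead_expo b ->
    [/\ I g, qcoef g b != 0 & vanish_below (rk b) g].
  by have [[f fP]|] := pselect (lead_expo b); [exists f|exists 0].
have d_ex e : exists d : expo n * expo n, lead_expo e -> d.1 \in B /\ e = d.1 + d.2.
  have [/B0d[b bB /expo_dvdP[u ->]]|] := pselect (lead_expo e); last by exists (0, 0).
  by exists (b, u); rewrite mem_undup.
have [g gP] := choice g_ex; have [d dP] := choice d_ex.
have {}gP b : b \in B -> [/\ I (g b), qcoef (g b) b != 0 & vanish_below (rk b) (g b)].
  by rewrite mem_undup => /B0S/gP.
exists B, g; split=> [b /gP[]//|f fI].
exists (quotient g d f); apply/eqP; rewrite -subr_eq0; apply/eqP.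
set r := f - _; apply: contrapT => r0.
pose p N := `[< exists s, rk s = N /\ qcoef r s != 0 >].
have [|N /asboolP[e [eN re]] emin] := @ex_minnP p.
  apply: contrapT => H; apply: r0; apply: qpsP => s.
  apply: contrapT => /eqP rs; apply: H; exists (rk s); apply/asboolP.
  by exists s.
have le : lead_expo e.
  (* The successor matters: the approximant must agree with [f] at [e] itself. *)
  have [f' If' ff'] := fI (rk e).+1.
  exists (f' - \sum_(b <- B) op (g b) (quotient g d f b)).
  have rE s : (rk s < (rk e).+1)%N -> qcoef r s =
      qcoef (f' - \sum_(b <- B) op (g b) (quotient g d f b)) s.
    by move/ff'; rewrite /r !qcoefB => /eqP; rewrite subr_eq0 => /eqP->.
  split; first 1 last.
  - by rewrite -rE.
  - move=> s se; rewrite -rE ?(ltn_trans se) //; apply: contrapT => /eqP rs.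
    have : (N <= rk s)%N by apply: emin; apply/asboolP; exists s.
    by rewrite leqNgt -eN se.
  - apply: ID => //; apply: IN; rewrite big_seq; elim/big_ind: _ => //.
    by move=> b /gP[gb _ _]; apply: IM.
by move/eqP: re; apply; apply: remainder_lead => //; exact: undup_uniq.
Qed.

End OneSided.

End Division.

(** * Prime ideals, links and Goldie rank in general rings *)

Section Rings.
Variable A : nzRingType.
Implicit Types (I J K N P Q : set A) (a b c r s x y z : A).

Definition right_noetherian : Prop :=
  forall I, right_ideal I -> exists l : seq A,
    (forall g, g \in l -> I g) /\
    forall J, right_ideal J -> (forall g, g \in l -> J g) -> I `<=` J.

Definition normal_mod P y : Prop :=
  (forall r, exists s, P (r * y - y * s)) /\ (forall r, exists s, P (y * r - s * y)).

Lemma right_idealN I a : right_ideal I -> I a -> I (- a).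
Proof. by move=> [_ _ IM] Ia; rewrite -mulrN1; apply: IM. Qed.

Lemma right_idealB I a b : right_ideal I -> I a -> I b -> I (a - b).
Proof. by move=> Ir Ia Ib; have [_ ID _] := Ir; apply: ID => //; apply: right_idealN. Qed.

Lemma right_ideal_subr I a b : right_ideal I -> I (a - b) -> I b -> I a.
Proof. by move=> [_ ID _] Iab Ib; rewrite -[a](subrK b); apply: ID. Qed.

Lemma right_ideal_subl I a b : right_ideal I -> I (a - b) -> I a -> I b.
Proof. by move=> Ir Iab Ia; rewrite -[b](subKr a); apply: right_idealB. Qed.

Lemma right_ideal_sum I (T : Type) (l : seq T) (p : pred T) (F : T -> A) :
  right_ideal I -> (forall i, p i -> I (F i)) -> I (\sum_(i <- l | p i) F i).
Proof. by move=> [I0 ID _] IF; elim/big_ind: _. Qed.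

Lemma ideal_annl I a : ideal I -> ideal [set b | forall r, I (a * r * b)].
Proof.
move=> [[I0 ID IM] IL]; split; [split=> [r|b c Ib Ic r|b s Ib r]|move=> s b Ib r] => /=.
- by rewrite mulr0.
- by rewrite mulrDr; apply: ID.
- by rewrite mulrA; apply: IM.
- by rewrite mulrA -[a * r * s]mulrA.
Qed.

Lemma ideal_annr I J : ideal I -> ideal [set a | forall b r, J b -> I (a * r * b)].
Proof.
move=> [[I0 ID IM] IL]; split;
  [split=> [b r _|a c Ia Ic b r Jb|a s Ia b r Jb]|move=> s a Ia b r Jb] => /=.
- by rewrite !mul0r.
- by rewrite !mulrDl; apply: ID; [apply: Ia|apply: Ic].
- by rewrite -[a * s * r]mulrA; apply: Ia.
- by rewrite -[s * a * r]mulrA -mulrA; apply/IL/Ia.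
Qed.

(** The two-sided annihilators [J] of [a] and [I] of [J], modulo [P], replace the ideals generated
    by [b] and [a]. *)
Lemma prime_elem P a b : prime_ideal P -> (forall r, P (a * r * b)) -> P a \/ P b.
Proof.
move=> [Pi _ Pprime] ab; pose J := [set b | forall r, P (a * r * b)].
pose I := [set a | forall b r, J b -> P (a * r * b)].
have [| | |IP|JP] := Pprime I J.
- exact: ideal_annr.
- exact: ideal_annl.
- have [Pr _] := Pi; move=> r [l lP ->]; rewrite big_seq.
  apply: right_ideal_sum => // -[c d] /lP[/= Ic Jd].
  by have := Ic d 1 Jd; rewrite mulr1.
- by left; apply: IP => c r; apply.
- by right; apply: JP.
Qed.

Lemma normal_mod_sub P Q y : P `<=` Q -> normal_mod P y -> normal_mod Q y.
Proof.
move=> PQ [yl yr]; split=> r.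
  by have [s /PQ] := yl r; exists s.
by have [s /PQ] := yr r; exists s.
Qed.

(** If [y * r] is in [P], normality rewrites [y * s * r] as [s' * y * r] modulo [P], so [prime_elem]
    applies. *)
Lemma normal_regular P y : prime_ideal P -> normal_mod P y -> ~ P y -> regular_mod P y.
Proof.
move=> Pp [yl yr] nPy r; have [[Pr PL] _ _] := Pp; have [_ _ PM] := Pr.
split=> Pyr.
  have [s|/nPy//|//] := prime_elem (a := y) (b := r) Pp.
  have [s' Ps] := yr s; apply: right_ideal_subr (Pr) _ (PL s' _ Pyr).
  by rewrite mulrA -mulrBl; apply: PM.
have [s|//|/nPy//] := prime_elem (a := r) (b := y) Pp.
have [s' Ps] := yl s; apply: right_ideal_subr (Pr) _ (PM _ s' Pyr).
by rewrite -!mulrA -mulrBr; apply: PL.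
Qed.

Lemma normal_mod_sets P y : ideal P -> normal_mod P y ->
  [set r * y + p | r in setT & p in P] = [set y * r + p | r in setT & p in P].
Proof.
move=> [[P0 PD PM] PL] [yl yr]; apply/seteqP; split=> z /= [r _ [p Pp <-]].
  have [s Ps] := yl r; exists s => //; exists (r * y - y * s + p); first exact: PD.
  by rewrite addrA subrKC.
have [s Ps] := yr r; exists s => //; exists (y * r - s * y + p); first exact: PD.
by rewrite addrA subrKC.
Qed.

(** The union of the chain is finitely generated, and its generators already lie in one member. *)
Lemma noetherian_acc (L : nat -> set A) : right_noetherian ->
  (forall i, right_ideal (L i)) -> (forall i, L i `<=` L i.+1) ->
  exists i, L i.+1 `<=` L i.
Proof.
move=> noeth Lr LS.
have Lmono i j : (i <= j)%N -> L i `<=` L j.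
  by apply: homo_leq => // [|Y X Z]; [exact: subset_refl|exact: subset_trans].
pose U : set A := [set x | exists i, L i x].
have [|l [lU lP]] := noeth U.
  split=> [|x y [i Lx] [j Ly]|x r [i Lx]].
  - by exists 0%N; have [] := Lr 0%N.
  - exists (maxn i j); have [_ LD _] := Lr (maxn i j).
    by apply: LD; [apply: Lmono Lx; rewrite leq_maxl|apply: Lmono Ly; rewrite leq_maxr].
  - by exists i; have [_ _ LM] := Lr i; apply: LM.
have [i li] : exists i, forall g, g \in l -> L i g.
  elim: l lU {lP} => [|g l IH] lU; first by exists 0%N.
  have [g' g'l|i iP] := IH; first by apply: lU; rewrite inE g'l orbT.
  have [j jP] := lU g (mem_head _ _); exists (maxn i j) => g'.
  rewrite inE => /orP[/eqP->|/iP]; first by apply: Lmono jP; rewrite leq_maxr.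
  by apply: Lmono; rewrite leq_maxl.
by exists i; apply: subset_trans (lP _ (Lr i) li) => x Lx; exists i.+1.
Qed.

(** * Normal elements across a link *)

Section Link.
Variables P Q J : set A.
Hypotheses (Pp : prime_ideal P) (Qp : prime_ideal Q) (Ji : ideal J).
Hypotheses (PQJ : ideal_mul P Q `<=` J) (JPQ : J `<` P `&` Q).
Hypothesis Jl : forall c m, regular_mod P c -> (P `&` Q) m -> J (c * m) -> J m.
Hypothesis Jr : forall c m, regular_mod Q c -> (P `&` Q) m -> J (m * c) -> J m.

Lemma ideal_mulM a b : P a -> Q b -> J (a * b).
Proof.
move=> Pa Qb; apply: PQJ; exists [:: (a, b)]; last by rewrite big_seq1.
by move=> p; rewrite inE => /eqP->.
Qed.

(** Let [y] be in [P] but not in [Q], and [m] in the intersection. Then [m * y] is [y * m'] modulo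
    [J], and [m'] is in [Q] by regularity of [y]; so [m * y] is in [J], and torsionfreeness puts [m]
    in [J]. Thus [J] would be the whole intersection. The other case is symmetric. *)
Lemma link_normal y : normal_mod J y -> P y <-> Q y.
Proof.
move=> yN; have [JsPQ nPQJ] := JPQ; have [Jri JL] := Ji.
have [[Pr PL] _ _] := Pp; have [[Qr QL] _ _] := Qp.
have [_ _ PM] := Pr; have [_ _ QM] := Qr.
have PN : normal_mod P y by apply: normal_mod_sub yN => x /JsPQ[].
have QN : normal_mod Q y by apply: normal_mod_sub yN => x /JsPQ[].
have [yl yr] := yN.
split=> yP; apply: contrapT => nyQ; apply: nPQJ => m [Pm Qm].
  have reg := normal_regular Qp QN nyQ.
  apply: (Jr reg) => //; have [m' Jm] := yl m.
  have Qm' : Q m'.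
    have [+ _] := reg m'; apply; have [_ +] := JsPQ _ Jm.
    by move/(right_ideal_subl Qr); apply; apply: QM.
  by apply: right_ideal_subr Jri Jm _; apply: ideal_mulM.
have reg := normal_regular Pp PN nyQ.
apply: (Jl reg) => //; have [m' Jm] := yr m.
have Pm' : P m'.
  have [_ +] := reg m'; apply; have [+ _] := JsPQ _ Jm.
  by move/(right_ideal_subl Pr); apply; apply: PL.
by apply: right_ideal_subr Jri Jm _; apply: ideal_mulM.
Qed.

End Link.

(** * Finiteness of the Goldie rank over a noetherian ring *)

Section GoldieRank.

Definition finite_udim N : Prop :=
  exists D, forall e, indep_right_ideals N e -> (e <= D)%N.

Lemma indep_subfamily N e (S : {set 'I_e}) (I : 'I_e -> set A) :
  (forall i, i \in S -> right_ideal (I i) /\ N `<` I i) ->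
  (forall a : 'I_e -> A, (forall i, i \in S -> I i (a i)) ->
     N (\sum_(i in S) a i) -> forall i, i \in S -> N (a i)) ->
  indep_right_ideals N #|S|.
Proof.
move=> IS indep; exists (fun j => I (enum_val j)); split=> [j|a aI aN j].
  exact/IS/enum_valP.
pose a' i := \sum_(j | enum_val j == i) a j.
have a'E j' : a' (enum_val j') = a j'.
  by rewrite /a' (big_pred1 j') // => j''; rewrite (inj_eq enum_val_inj).
rewrite -a'E; apply: indep (enum_valP j) => [i iS|].
  by rewrite -(enum_rankK_in iS iS) a'E.
by rewrite big_enum_val /=; under eq_bigr do rewrite a'E.
Qed.

(* Among the summands I_i, take a maximal set S whose sum meets K trivially:
   these survive modulo K, and each of the others yields a nonzero submodule of
   K, hence a nonzero submodule modulo L. *)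
Lemma finite_udim_meet N K L :
  right_ideal N -> right_ideal K -> right_ideal L -> N `<=` K -> N `<=` L ->
  K `&` L `<=` N -> finite_udim K -> finite_udim L -> finite_udim N.
Proof.
move=> Nr Kr Lr NK NL KLN [DK KP] [DL LP]; exists (DK + DL)%N => e [I [Ir Iind]].
have [N0 ND NM] := Nr; have [K0 KD KM] := Kr; have [L0 LD LM] := Lr.
have I0 i : I i 0 by have [[]] := Ir i.
have IND i : forall a b, I i a -> I i b -> I i (a + b) by have [[]] := Ir i.
have IM i : forall a r, I i a -> I i (a * r) by have [[]] := Ir i.
have NI i : N `<=` I i by have [_ []] := Ir i.
pose p (S : {set 'I_e}) := `[< forall a : 'I_e -> A, (forall i, I i (a i)) ->
  (forall i, i \notin S -> a i = 0) -> K (\sum_i a i) -> forall i, N (a i) >].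
have p0 : p finset.set0 by apply/asboolP => a _ a0 _ i; rewrite a0 ?inE.
case: (arg_maxnP (fun S : {set 'I_e} => #|S|) p0) => S /asboolP pS Smax.
have {Smax}nS i : i \notin S -> exists a : 'I_e -> A, [/\ forall j, I j (a j),
    forall j, j \notin i |: S -> a j = 0, K (\sum_j a j) & exists j, ~ N (a j)].
  move=> iS; apply: contrapT => H.
  have : (#|i |: S| <= #|S|)%N.
    apply: Smax; apply/asboolP => a aI a0 aK j; apply: contrapT => Naj.
    by apply: H; exists a; split=> //; exists j.
  by rewrite cardsU1 iS ltnn.
rewrite -(card_ord e) -(cardsC S) leq_add //; [apply: KP|apply: LP].
  (* For [i] in [S], the right ideals [I i + K] are independent modulo [K]. *)
  apply: (indep_subfamily (I := fun i => [set x + y | x in I i & y in K])).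
    move=> i iS; split.
      split=> [|_ _ [x Ix [y Ky <-]] [x' Ix' [y' Ky' <-]]|_ r [x Ix [y Ky <-]]].
      - by exists 0 => //; exists 0; rewrite ?addr0.
      - by exists (x + x'); [exact: IND|exists (y + y'); [exact: KD|rewrite addrACA]].
      - by exists (x * r); [exact: IM|exists (y * r); [exact: KM|rewrite mulrDl]].
    split=> [x Kx|H]; first by exists 0 => //; exists x; rewrite ?add0r.
    have [_ [_]] := Ir i; apply=> x Ix.
    have Kx : K x by apply: H; exists x => //; exists 0; rewrite ?addr0.
    have := pS (fun j => if j == i then x else 0) _ _ _ i; rewrite eqxx; apply.
    - by move=> j; case: eqP => [->|].
    - by move=> j; case: eqP => // ->; rewrite iS.
    - by rewrite -big_mkcond big_pred1_eq.
  move=> z zI zK.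
  have [xy xyP] : exists xy : 'I_e -> A * A, forall i,
      i \in S -> [/\ I i (xy i).1, K (xy i).2 & z i = (xy i).1 + (xy i).2].
    have xy_ex i : exists xy : A * A, i \in S -> [/\ I i xy.1, K xy.2 & z i = xy.1 + xy.2].
      have [/zI[x Ix [y Ky <-]]|] := boolP (i \in S); last by exists (0, 0).
      by exists (x, y).
    by have [xy xyP] := choice xy_ex; exists xy.
  have xN : forall i, N (if i \in S then (xy i).1 else 0).
    apply: pS => [i|i /negPf->//|].
      by case: ifP => // /xyP[].
    rewrite -big_mkcond /=.
    have -> : \sum_(i in S) (xy i).1 = \sum_(i in S) z i - \sum_(i in S) (xy i).2.
      by rewrite -sumrB; apply: eq_bigr => i /xyP[_ _ ->]; rewrite addrK.
    by apply: right_idealB => //; apply: right_ideal_sum => // i /xyP[].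
  move=> i iS; have := xN i; rewrite iS => /NK Kx.
  by have [_ Ky ->] := xyP i iS; apply: KD.
(* For [i] outside [S], take the elements congruent modulo [L] to a sum in [K] whose components sit
   in [S] and at [i]. *)
pose adm i (a : 'I_e -> A) := [/\ forall j, I j (a j), forall j, j \notin i |: S -> a j = 0
  & K (\sum_j a j)].
apply: (indep_subfamily
  (I := fun i => [set z | exists2 a : 'I_e -> A, adm i a & L (z - \sum_j a j)])).
  move=> i; rewrite inE => iS; split.
    split=> [|z z' [a [aI a0 aK] zL] [a' [a'I a'0 a'K] z'L]|z r [a [aI a0 aK] zL]].
    - exists (fun=> 0); first by split=> //; rewrite big1.
      by rewrite big1 // subr0.
    - exists (fun j => a j + a' j); last by rewrite big_split opprD addrACA; apply: LD.
      split=> [j|j ji|]; [exact: IND|by rewrite a0 ?a'0 ?addr0|].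
      by rewrite big_split; apply: KD.
    - exists (fun j => a j * r); last by rewrite -mulr_suml -mulrBl; apply: LM.
      split=> [j|j ji|]; [exact: IM|by rewrite a0 ?mul0r|].
      by rewrite -mulr_suml; apply: KM.
  split=> [z Lz|H].
    exists (fun=> 0); first by split=> //; rewrite big1.
    by rewrite big1 // subr0.
  have [a [aI a0 aK [j]]] := nS i iS; apply; apply: Iind => //; apply: KLN; split=> //.
  by apply: H; exists a; rewrite ?subrr.
move=> z zI zL.
have [a aP] : exists a : 'I_e -> 'I_e -> A, forall i,
    i \in ~: S -> adm i (a i) /\ L (z i - \sum_j a i j).
  have a_ex i : exists a : 'I_e -> A, i \in ~: S -> adm i a /\ L (z i - \sum_j a j).
    have [/zI[a aP]|] := boolP (i \in ~: S); last by exists (fun=> 0).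
    by exists a.
  by have [a aP] := choice a_ex; exists a.
have cN j : N (\sum_(i in ~: S) a i j).
  apply: (Iind (fun j => \sum_(i in ~: S) a i j)) => [j'|].
    have [Ir' _] := Ir j'; apply: right_ideal_sum => // i /aP[[]]//.
  rewrite exchange_big; apply: KLN; split.
    by apply: right_ideal_sum => // i /aP[[]].
  apply: right_ideal_subl Lr _ zL; rewrite -sumrB.
  by apply: right_ideal_sum => // i /aP[].
move=> i iS; have [[aI a0 aK] zaL] := aP i iS.
(* For [j] outside [S] other than [i], [a j] has no component at [i], so [cN i] isolates [a i i]. *)
have aii : N (a i i).
  have := cN i; rewrite (bigD1 i) //= big1 ?addr0 // => j /andP[jS ji].
  have [[_ + _] _] := aP j jS; apply; rewrite !inE eq_sym (negPf ji) /=.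
  by rewrite inE in iS.
apply: right_ideal_subr Lr zaL _; apply: NL; apply: right_ideal_sum => // j _.
have [->//|ji] := eqVneq j i.
(* Without its component at [i], the family [a i] still sums into [K] and is now supported on
   [S]. *)
have := pS (fun j => if j == i then 0 else a i j) _ _ _ j; rewrite (negPf ji); apply.
- by move=> j'; case: ifP.
- move=> j' j'S; case: eqP => // /eqP j'i; apply: a0.
  by rewrite !inE (negPf j'i).
- rewrite (bigD1 i) //= eqxx add0r.
  have -> : \sum_(j' | j' != i) (if j' == i then 0 else a i j') = \sum_j' a i j' - a i i.
    rewrite [in RHS](bigD1 i) //= addrAC subrr add0r.
    by apply: eq_bigr => j' /negPf->.
  by apply: right_idealB => //; apply: NK.
Qed.

(** The bound is 1: an element [x] common to two independent ideals, used as the components [x] and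
    [- x] of a zero sum, lies in [N]. *)
Lemma finite_udim_uniform N : right_ideal N ->
  (forall K L, right_ideal K -> right_ideal L -> N `<` K -> N `<` L ->
     ~ K `&` L `<=` N) -> finite_udim N.
Proof.
move=> [N0 _ _] Nunif; exists 1%N => e [I [Ir Iind]]; rewrite leqNgt; apply/negP => e2.
pose i0 := Ordinal (ltnW e2); pose i1 := Ordinal e2.
have [I0r NI0] := Ir i0; have [I1r NI1] := Ir i1.
apply: (Nunif _ _ I0r I1r NI0 NI1) => x [x0 x1].
have := Iind (fun i => if i == i0 then x else if i == i1 then - x else 0) _ _ i0.
rewrite eqxx; apply.
  move=> i; case: eqP => [->//|_]; case: eqP => [->|_]; first exact: right_idealN.
  by have [[]] := Ir i.
rewrite (bigD1 i0) //= (bigD1 i1) //= big1 ?addr0 ?subrr //.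
by move=> i /andP[/negPf-> /negPf->].
Qed.

(** Noetherian induction: a right ideal is either irreducible for intersection, where the bound is
    1, or the intersection of two strictly larger ones, where [finite_udim_meet] applies. *)
Lemma noetherian_finite_udim N : right_noetherian -> right_ideal N -> finite_udim N.
Proof.
move=> noeth Nr; apply: contrapT => nN.
have up_ex K : exists K', (right_ideal K /\ ~ finite_udim K) ->
    [/\ right_ideal K', ~ finite_udim K' & K `<` K'].
  have [[Kr nK]|] := pselect (right_ideal K /\ ~ finite_udim K); last by exists K.
  apply: contrapT => H; apply: nK; apply: contrapT => nK.
  have fin K' : right_ideal K' -> K `<` K' -> finite_udim K'.
    by move=> K'r KK'; apply: contrapT => nK'; apply: H; exists K'.
  apply: (nK); apply: finite_udim_uniform => // K' L' K'r L'r KK' KL' KL.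
  apply: nK; apply: finite_udim_meet KL _ _ => //; [exact: (proj1 KK')|exact: (proj1 KL')| |];
    exact: fin.
have [up upP] := choice up_ex.
have itP i : right_ideal (iter i up N) /\ ~ finite_udim (iter i up N).
  by elim: i => //= i /upP[].
have [i|i|i] := @noetherian_acc (fun i => iter i up N) noeth.
- by have [] := itP i.
- by have [_ _ []] := upP _ (itP i).
- by have [_ _ [_]] := upP _ (itP i).
Qed.

Lemma goldie_rank_exists N : right_noetherian -> right_ideal N ->
  exists d, goldie_rank N d.
Proof.
move=> noeth /(noetherian_finite_udim noeth)[D DP].
pose p d := `[< indep_right_ideals N d >].
have [|d|d /asboolP dP dmax] := @ex_maxnP p D.
- exists 0%N; apply/asboolP; exists (fun=> setT).
  by split=> [[]//|a _ _ []].
- by move/asboolP/DP.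
- by exists d; split=> // e eP; apply: dmax; apply/asboolP.
Qed.

End GoldieRank.
End Rings.

(** * The second layer condition *)

Section SecondLayer.
Variable A : nzRingType.

(** For a converse ring this is the chain condition on right ideals, so one argument can serve both
    sides. *)
Definition left_acc : Prop := forall L : nat -> set A,
  (forall i, [/\ L i 0, forall a b, L i a -> L i b -> L i (a + b)
    & forall a r, L i a -> L i (r * a)]) ->
  (forall i, L i `<=` L i.+1) -> exists i, L i.+1 `<=` L i.

Definition normal_separation : Prop := forall P Q : set A,
  prime_ideal P -> prime_ideal Q -> Q `<` P ->
  exists y, [/\ P y, ~ Q y & normal_mod Q y].

(** If [I J] kills [N/U] but [J] does not, the part of [N/U] killed by [I] is nonzero. By maximality
    it has the same annihilator as [N/U], which therefore contains [I]. *)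
Lemma max_annihilator_prime (M : lmodType A) (U : set M) (Q : set A) :
  submodule U -> max_annihilator U Q -> prime_ideal Q.
Proof.
move=> [U0 UD UM] [[N [[N0 ND NM] [UN nNU] ->]] Qmax].
have annI : ideal (annihilator N U).
  split; [split=> [m _|a b ha hb m Nm|a r ha m Nm]|move=> r a ha m Nm] => /=.
  - by rewrite scale0r.
  - by rewrite scalerDl; apply: UD; [apply: ha|apply: hb].
  - by rewrite -scalerA; apply/ha/NM.
  - by rewrite -scalerA; apply/UM/ha.
split=> // [annT|I J Ii Ji IJ].
  apply: nNU => m Nm; have : annihilator N U 1 by rewrite annT.
  by move/(_ _ Nm); rewrite scale1r.
have [|nJ] := pselect (J `<=` annihilator N U); first by right.
left; have [[_ _ IM] IL] := Ii; have [[_ _ JM] JL] := Ji.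
pose N' : set M := [set m | N m /\ forall a, I a -> U (a *: m)].
have N's : submodule N'.
  split=> [|m m' [Nm Im] [Nm' Im']|r m [Nm Im]].
  - by split=> // a _; rewrite scaler0.
  - by split=> [|a Ia]; [exact: ND|rewrite scalerDr; apply: UD; [apply: Im|apply: Im']].
  - by split=> [|a Ia]; [exact: NM|rewrite scalerA; apply/Im/IM].
have UN' : U `<` N'.
  split=> [m Um|H]; first by split=> [|a _]; [exact: UN|exact: UM].
  apply: nJ => b Jb m Nm; apply: H; split=> [|a Ia]; first exact: NM.
  rewrite scalerA; apply: (IJ) (Nm); exists [:: (a, b)]; last by rewrite big_seq1.
  by move=> p; rewrite inE => /eqP->.
have -> : annihilator N U = annihilator N' U.
  by apply: Qmax => // r hr m [Nm _]; apply: hr.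
by move=> a Ia m [_]; apply.
Qed.

(* Fitting's argument on the cyclic module A m, for m in M' outside U: an
   element y of P outside Q, normal modulo Q, kills U, while its powers do not
   kill A m, so that a power of y maps A m onto a nonzero submodule missing U. *)
Lemma strong_second_layer_left :
  left_acc -> normal_separation -> left_strong_second_layer A.
Proof.
move=> acc sep M [U [M' [P [Q [aff ess [M's UM' _] QP QM']]]]].
have [[Us _ _] Pmax UE Qmax QU] := aff.
have Qp := max_annihilator_prime Us Qmax.
have Pp : prime_ideal P.
  apply: max_annihilator_prime Pmax; split=> [//|m m' /= -> ->|r m /= ->].
    by rewrite addr0.
  by rewrite scaler0.
have [y [Py nQy yN]] := sep _ _ Pp Qp QP.
have reg := normal_regular Qp yN nQy.
have [[[Q0 QD QM] QL] QT _] := Qp; have [yl yr] := yN.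
have [M'0 M'D M'M] := M's; have [U0 UD UM] := Us.
(* Powers of [y] are again normal modulo [Q]. *)
have yXl i r : exists s, Q (r * y ^+ i - y ^+ i * s).
  elim: i r => [|i IH] r; first by exists r; rewrite expr0 mulr1 mul1r subrr.
  have [s Qs] := yl r; have [s' Qs'] := IH s; exists s'.
  have -> : r * y ^+ i.+1 - y ^+ i.+1 * s' =
      (r * y - y * s) * y ^+ i + y * (s * y ^+ i - y ^+ i * s').
    by rewrite mulrBl mulrBr !exprS !mulrA addrA subrK.
  by apply: QD; [exact: QM|exact: QL].
have yXr i r : exists s, Q (y ^+ i * r - s * y ^+ i).
  elim: i r => [|i IH] r; first by exists r; rewrite expr0 mulr1 mul1r subrr.
  have [s Qs] := IH r; have [s' Qs'] := yr s; exists s'.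
  have -> : y ^+ i.+1 * r - s' * y ^+ i.+1 =
      y * (y ^+ i * r - s * y ^+ i) + (y * s - s' * y) * y ^+ i.
    by rewrite mulrBl mulrBr !exprS !mulrA addrA subrK.
  by apply: QD; [exact: QL|exact: QM].
have QE a b v : M' v -> Q (a - b) -> a *: v = b *: v.
  by move=> M'v /QM'/(_ M'v)/eqP; rewrite scalerBl subr_eq0 => /eqP.
have [m M'm nUm] : exists2 m, M' m & ~ U m.
  apply: contrapT => H; have [_] := UM'; apply=> m M'm.
  by apply: contrapT => nUm; apply: H; exists m.
(* The annihilators of [m] under [y ^+ i] increase with [i]; they are left ideals because [y ^+ i]
   is normal modulo [Q], which kills [M']. *)
have [n Ln] : exists n, forall r, y ^+ n.+1 *: (r *: m) = 0 -> y ^+ n *: (r *: m) = 0.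
  have [i|i r|n Ln] := acc (fun i => [set r | y ^+ i *: (r *: m) = 0]).
  - split=> [|a b /= ha hb|a r /= ha]; first by rewrite /= scale0r scaler0.
      by rewrite scalerDl scalerDr ha hb addr0.
    have [s Qs] := yXr i r.
    by rewrite scalerA mulrA -scalerA (QE _ _ _ (M'M a m M'm) Qs) -scalerA ha scaler0.
  - by rewrite /= exprS -scalerA => ->; rewrite scaler0.
  - by exists n => r; apply: Ln.
pose N : set M := [set v | exists r, v = y ^+ n *: (r *: m)].
have Ns : submodule N.
  split=> [|_ _ [r ->] [s ->]|s _ [r ->]].
  - by exists 0; rewrite scale0r scaler0.
  - by exists (r + s); rewrite scalerDl scalerDr.
  - have [s' Qs'] := yXl n s; exists (s' * r).
    by rewrite scalerA (QE _ _ _ (M'M r m M'm) Qs') -!scalerA.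
have nQX i : ~ Q (y ^+ i).
  elim: i => [Q1|i IH]; last by rewrite exprS => /(proj1 (reg _)).
  by apply: QT; apply/seteqP; split=> // r _; rewrite -[r]mulr1; apply: QL.
have N0 : [set 0] `<` N.
  split=> [_ ->|H]; first by have [] := Ns.
  apply: (nQX n).
  pose N2 : set M := [set v | exists r, exists2 u, U u & v = r *: m + u].
  (* If [y ^+ n] killed [A m], it would annihilate [(A m + U)/U], whose annihilator is [Q] by
     maximality. *)
  have -> : Q = annihilator N2 U.
    apply: (proj2 Qmax) => [||r Qr v _]; last exact: QU.
      split=> [|_ _ [r [u Uu ->]] [s [v Uv ->]]|s _ [r [u Uu ->]]].
      - by exists 0, 0; rewrite ?scale0r ?addr0.
      - by exists (r + s), (u + v); [exact: UD|rewrite scalerDl addrACA].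
      - by exists (s * r), (s *: u); [exact: UM|rewrite scalerDr scalerA].
    split=> [u Uu|N2U]; first by exists 0, u; rewrite ?scale0r ?add0r.
    by apply: nUm; apply: N2U; exists 1, 0; rewrite ?scale1r ?addr0.
  move=> _ [r [u Uu ->]]; rewrite scalerDr; apply: UD; last exact: UM.
  by have -> : y ^+ n *: (r *: m) = 0 by apply: H; exists r.
(* An element [y ^+ n *: (r *: m)] of [U] is killed by [y], hence is 0 by the choice of [n]; this
   contradicts essentiality. *)
have [_ []] := ess N Ns N0 => _ [[r ->]]; rewrite UE => /(_ _ Py).
by rewrite scalerA -exprS => /Ln.
Qed.

End SecondLayer.

Lemma prime_converse (A : nzRingType) (P : set A) :
  prime_ideal (A := A^c) P -> prime_ideal P.
Proof.
have idealC (I : set A) : ideal (A := A^c) I <-> ideal I.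
  by split=> -[[I0 ID IM] IL]; (split; [split=> // a r; exact: IL|move=> r a; exact: IM]).
move=> [Pi PT Pp]; split=> //; first exact/idealC.
move=> I J Ii Ji IJ; apply/or_comm; apply: Pp; [exact/idealC|exact/idealC|].
move=> _ [l lP ->]; apply: IJ; exists [seq (p.2, p.1) | p <- l].
  by move=> _ /mapP[p /lP[p1 p2] ->].
by rewrite big_map.
Qed.

(** Normality modulo an ideal is symmetric in the two sides, so separation passes to the converse
    ring. *)
Lemma noetherian_strong_second_layer (A : nzRingType) :
  right_noetherian A -> right_noetherian A^c -> normal_separation A ->
  strong_second_layer A.
Proof.
move=> Ar Al sep; split; apply: strong_second_layer_left => //.
- move=> L LI; apply: (noetherian_acc Ar) => i; have [L0 LD LM] := LI i.
  by split=> // a r; apply: LM.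
- move=> P Q /prime_converse Pp /prime_converse Qp /(sep _ _ Pp Qp)[y [Py nQy [yl yr]]].
  by exists y; split.
- move=> L LI; apply: (noetherian_acc Al) => i; have [L0 LD LM] := LI i.
  by split=> // a r; apply: LM.
Qed.

Lemma indep_right_ideals_transport (A : nzRingType) (t u : A -> A) (P : set A) d :
  cancel t u -> cancel u t -> {morph u : a b / a + b} -> {morph u : a b / a * b} ->
  indep_right_ideals P d -> indep_right_ideals [set x | P (u x)] d.
Proof.
move=> tK uK uD uM [I [Ir Iind]].
have u0 : u 0 = 0 by apply: (addIr (u 0)); rewrite -uD !add0r.
exists (fun i => [set x | I i (u x)]); split=> [i|a aI aP i].
  have [[I0 ID IM] [PI nIP]] := Ir i; split.
    split=> [|a b|a r] /=; first by rewrite u0.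
      by rewrite uD; apply: ID.
    by rewrite uM; apply: IM.
  split=> [x /PI //|H]; apply: nIP => x Ix.
  by have /= := H (t x); rewrite tK; apply.
apply: (Iind (fun i => u (a i))) => //; move: aP => /=.
by rewrite (big_morph u uD u0).
Qed.

(** * q-commutative power series *)

Section QSeries.
Variables (k : fieldType) (n : nat) (q : 'M[k]_n).
Hypothesis hq : mult_antisym q.
Local Notation R := (qpseries q).
Local Notation X := (qps_monom q).
Implicit Types (f g r y : R) (s t a b : expo n) (N : nat) (S : set (expo n)).

Lemma qcoefM_supp f g s :
  (forall a b, a + b = s -> qcoef f a = 0 \/ qcoef g b = 0) -> qcoef (f * g) s = 0.
Proof.
move=> H; rewrite /= big1 // => a _; rewrite big1 // => b /eqP/H[]->.
  by rewrite !mul0r.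
by rewrite mulr0 mul0r.
Qed.

(** * Noetherianity and closed one-sided ideals *)

Lemma right_basis (I : set R) : right_ideal I ->
  exists (B : seq (expo n)) (g : expo n -> R), (forall b, b \in B -> I (g b)) /\
  forall f, (forall N, exists2 f', I f' & vanish_below N (f - f')) ->
    exists h : expo n -> R, f = \sum_(b <- B) g b * h b.
Proof.
move=> Ir; have [I0 ID IM] := Ir.
apply: (one_sided_basis (op := fun f g : R => f * g) (w := qtwist q)) => //.
- by move=> f g h; rewrite mulrDr.
- by move=> f c g; rewrite -scalerAr.
- by move=> f g s /qcoefM_supp.
- by move=> f s t; apply: qcoef_monomr.
- exact: qtwist_neq0.
- by move=> f; apply: right_idealN.
Qed.

Lemma left_basis (I : set R^c) : right_ideal I ->
  exists (B : seq (expo n)) (g : expo n -> R), (forall b, b \in B -> I (g b)) /\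
  forall f, (forall N, exists2 f', I f' & vanish_below N (f - f')) ->
    exists h : expo n -> R, f = \sum_(b <- B) h b * g b.
Proof.
move=> Ir; have [I0 ID IM] := Ir.
apply: (one_sided_basis (op := fun f g : R => g * f) (w := fun a b => qtwist q b a)) => //.
- by move=> f g h; rewrite mulrDl.
- by move=> f c g; rewrite -scalerAl.
- move=> f g s H; apply: qcoefM_supp => a b ab.
  by have [|f0|g0] := H b a; [rewrite addrC|right|left].
- by move=> f s t; rewrite addrC; apply: qcoef_monoml.
- by move=> s t; apply: qtwist_neq0.
- by move=> f; apply: (right_idealN (A := R^c) Ir).
Qed.

Lemma right_ideal_closed (I : set R) : right_ideal I -> adic_closed I.
Proof.
move=> Ir; have [B [g [gI gen]]] := right_basis Ir; move=> f /gen[h ->].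
by rewrite big_seq; apply: right_ideal_sum => // b /gI; case: Ir => _ _; apply.
Qed.

Lemma vanish_below0 N f : vanish_below N (f - f).
Proof. by move=> s _; rewrite subrr. Qed.

Lemma qps_right_noetherian : right_noetherian R.
Proof.
move=> I Ir; have [B [g [gI gen]]] := right_basis Ir.
exists [seq g b | b <- B]; split=> [_ /mapP[b /gI Ib ->]//|J Jr JB f If].
have [N|h ->] := gen f; first by exists f => //; apply: vanish_below0.
rewrite big_seq; apply: right_ideal_sum => // b bB.
by have [_ _ JM] := Jr; apply/JM/JB/map_f.
Qed.

Lemma qps_left_noetherian : right_noetherian R^c.
Proof.
move=> I Ir; have [B [g [gI gen]]] := left_basis Ir.
exists [seq (g b : R^c) | b <- B]; split=> [_ /mapP[b /gI Ib ->]//|J Jr JB f If].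
have [N|h ->] := gen f; first by exists f => //; apply: vanish_below0.
have [J0 JD JM] := Jr; rewrite big_seq; elim/big_ind: _ => // b bB.
by apply: (JM (g b) (h b)); apply: JB; apply: map_f.
Qed.

(* x^a x^b = beta a b *: x^b x^a *)
Definition beta a b : k := qtwist q a b / qtwist q b a.

Lemma beta_neq0 a b : beta a b != 0.
Proof. by rewrite mulf_neq0 ?invr_eq0 ?qtwist_neq0. Qed.

Lemma betaDr a b c : beta a (b + c) = beta a b * beta a c.
Proof. by rewrite /beta qtwistDr qtwistDl invfM mulrACA. Qed.

Lemma betaDl a b c : beta (a + b) c = beta a c * beta b c.
Proof. by rewrite /beta qtwistDr qtwistDl invfM mulrACA. Qed.

Lemma beta0l a : beta 0 a = 1.
Proof. by rewrite /beta qtwist0l qtwist0r divr1. Qed.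

(** Conjugation by [x^a] is diagonal on monomials, so it is defined coefficientwise, without
    denominators. *)
Definition monom_conj a : R -> R := xscale (beta a).
Definition monom_conjV a : R -> R := xscale (fun s => (beta a s)^-1).

Lemma monom_conjK a : cancel (monom_conj a) (monom_conjV a).
Proof. by move=> r; apply: qpsP => s /=; rewrite mulfK ?beta_neq0. Qed.

Lemma monom_conjVK a : cancel (monom_conjV a) (monom_conj a).
Proof. by move=> r; apply: qpsP => s /=; rewrite mulfVK ?beta_neq0. Qed.

(** Exchanging [x^a] and [x^b] costs [beta a b]; when this depends only on [a] over the supports,
    the coefficients of [f] absorb it. *)
Lemma mulr_twist f g (c : expo n -> k) :
  (forall a b, qcoef f a != 0 -> qcoef g b != 0 -> beta a b = c a) ->
  f * g = g * xscale c f.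
Proof.
move=> H; apply: qpsP => s; have sN := expo_boundP s.
rewrite !(qps_mulE _ _ sN) exchange_big; apply: eq_bigr => b _; apply: eq_bigr => a _.
rewrite [expo_of b + _]addrC; congr (_ *+ _) => /=.
have [->|fa] := eqVneq (qcoef f (expo_of a)) 0; first by rewrite !mul0r mulr0 mul0r.
have [->|gb] := eqVneq (qcoef g (expo_of b)) 0; first by rewrite !mul0r mulr0 mul0r.
rewrite -(H _ _ fa gb) /beta.
by field; apply: qtwist_neq0.
Qed.

Lemma monom_conjE a r : monom_conj a r * X a = X a * r.
Proof.
rewrite -[r in RHS](monom_conjK a); apply: mulr_twist => b c _ /=.
have [->|] := eqVneq c a; last by rewrite eqxx.
by rewrite /beta invf_div.
Qed.

Lemma monom_conjVE a r : r * X a = X a * monom_conjV a r.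
Proof. by rewrite -monom_conjE monom_conjVK. Qed.

(** Induction on the degree of [a], splitting off one variable at a time. *)
Lemma monom_conj_group a : qconj_group (monom_conj a).
Proof.
have [N aN] := ubnP (expo_deg a); elim: N a aN => // N IH a aN.
have [a0|[i ai]] : a = 0 \/ exists i, (0 < a i)%N.
  have [/existsP[i ai]|/existsPn H] := boolP [exists i, (0 < a i)%N].
    by right; exists i.
  by left; apply/ffunP => i; rewrite ffunE; apply/eqP; rewrite -leqn0 leqNgt.
  suff -> : monom_conj a = id by apply: QConj_id.
  by apply/funext => r; apply: qpsP => s; rewrite a0 /= beta0l mulr1.
have /expo_dvdP[b aE] : expo_dvd (delta_expo i) a.
  by apply/forallP => j; rewrite ffunE; case: eqP => // ->.
have -> : monom_conj a = monom_conj (delta_expo i) \o monom_conj b.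
  by apply/funext => r; apply: qpsP => s; rewrite /= aE betaDl mulrCA mulrC mulrA.
apply: QConj_comp; first by apply: (@QConj_gen _ _ _ i) => r; apply: monom_conjE.
apply: IH; move: aN; rewrite aE expo_degD ltnS; apply: leq_trans.
by rewrite -[X in (X < _)%N]add0n ltn_add2r /expo_deg (bigD1 i) //= ffunE eqxx.
Qed.

Lemma idealZ (I : set R) (c : k) f : right_ideal I -> I f -> I (c *: f).
Proof. by move=> [_ _ IM] If; rewrite -[f]mulr1 scalerAr; apply: IM. Qed.

Lemma monom_normal (J : set R) a : ideal J -> normal_mod J (X a).
Proof.
move=> [[J0 _ _] _]; split=> r.
  by exists (monom_conjV a r); rewrite monom_conjVE subrr.
by exists (monom_conj a r); rewrite monom_conjE subrr.
Qed.

Section Primes.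
Variable P : set R.
Hypothesis Pp : prime_ideal P.

Lemma monom_regular a : ~ P (X a) -> regular_mod P (X a).
Proof. by apply: normal_regular => //; apply: monom_normal; case: Pp. Qed.

Lemma prime_not1 : ~ P 1.
Proof.
have [[_ PL] PT _] := Pp => P1; apply: PT; apply/seteqP; split=> // r _.
by rewrite -[r]mulr1; apply: PL.
Qed.

Lemma prime_monomD a b : ~ P (X a) -> ~ P (X b) -> ~ P (X (a + b)).
Proof.
move=> Pa Pb Pab; have [[Pr _] _ _] := Pp; apply: Pb.
apply: (proj1 (monom_regular Pa _)).
have : P (qtwist q a b *: X (a + b)) by apply: idealZ.
by rewrite -qps_monomM.
Qed.

Lemma prime_conj_stable a r : ~ P (X a) -> P r -> P (monom_conj a r).
Proof.
move=> /monom_regular Pa Pr; apply: (proj2 (Pa _)); rewrite monom_conjE.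
by have [[_ PL] _ _] := Pp; apply: PL.
Qed.

End Primes.

(** The finite truncations of [r] lie in [B], which is closed. *)
Lemma right_ideal_supp (B : set R) r : right_ideal B ->
  (forall s, qcoef r s != 0 -> B (X s)) -> B r.
Proof.
move=> Br rB; apply: (right_ideal_closed Br) => N.
have [l lN] := rk_initial_finite n N.
exists (\sum_(t <- undup l) qcoef r t *: X t).
  apply: right_ideal_sum => // t _.
  have [->|/rB] := eqVneq (qcoef r t) 0; last exact: idealZ.
  by rewrite scale0r; case: Br.
move=> s /lN sl; rewrite qcoefB qcoef_sum (bigD1_seq s) ?mem_undup ?undup_uniq //=.
rewrite eqxx mulr1 big1 ?addr0 ?subrr // => t ts.
by rewrite eq_sym (negPf ts) mulr0.
Qed.

(** * Isotypic parts under conjugation by monomials *)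

Section Isotypic.
Variable S : set (expo n).

(* x^s and x^t have the same eigenvalues under all the x^a with a in S. *)
Definition twist_sim s t : Prop := forall a, S a -> beta a t = beta a s.

Definition isotypic_proj b f : R :=
  QPSeries q (fun s => if `[< twist_sim b s >] then qcoef f s else 0).

(** Modulo [B], any [r] may be replaced by its part supported on [S]. For [a] in [S], [beta a] is
    constant on the support of [y], so [mulr_twist] moves [y] past this part up to a rescaling. *)
Lemma twist_homog_normal (B : set R) b y : ideal B ->
  (forall t, ~ S t -> B (X t)) ->
  (forall s, qcoef y s != 0 -> twist_sim b s) -> normal_mod B y.
Proof.
move=> [Br BL] BS yb.
pose rS r : R := QPSeries q (fun s => if `[< S s >] then qcoef r s else 0).
have rB r : B (r - rS r).
  apply: right_ideal_supp => // s; rewrite qcoefB /=.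
  by case: asboolP => [_|/BS//]; rewrite subrr eqxx.
have rSS r s : qcoef (rS r) s != 0 -> S s by rewrite /=; case: asboolP => //; rewrite eqxx.
split=> r.
  exists (xscale (fun a => beta a b) (rS r)).
  rewrite -mulr_twist; last by move=> a c /rSS Sa /yb; apply.
  by rewrite -mulrBl; have [_ _ BM] := Br; apply: BM.
exists (xscale (fun a => (beta a b)^-1) (rS r)).
have -> : xscale (fun a => (beta a b)^-1) (rS r) * y = y * rS r.
  have {2}-> : rS r = xscale (fun a => beta a b) (xscale (fun a => (beta a b)^-1) (rS r)).
    by apply: qpsP => s /=; rewrite mulfVK ?beta_neq0.
  apply: mulr_twist => a c fa /yb; apply; apply: (rSS r).
  by apply: contraNneq fa => /= ->; rewrite mul0r.
by rewrite -mulrBr; apply: BL.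
Qed.

(* Modulo any truncation only finitely many classes are left, and those other
   than the class of b are killed one at a time by the maps
   (monom_conj a - beta a s) / (beta a b - beta a s). *)
Lemma isotypic_proj_mem (I : set R) b f : right_ideal I ->
  (forall a r, S a -> I r -> I (monom_conj a r)) -> I f -> I (isotypic_proj b f).
Proof.
move=> Ir IS If; apply: (right_ideal_closed Ir) => N.
have [l lN] := rk_initial_finite n N.
suff [g [Ig gb gl]] : exists g, [/\ I g, forall s, twist_sim b s -> qcoef g s = qcoef f s
    & forall s, s \in l -> ~ twist_sim b s -> qcoef g s = 0].
  exists g => // s /lN sl; rewrite qcoefB /=; case: asboolP => [/gb->|/gl->//].
    exact: subrr.
  exact: subrr.
elim: l {N lN} => [|e l [g [Ig gb gl]]]; first by exists f.
have [eb|neb] := pselect (twist_sim b e).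
  by exists g; split=> // s; rewrite inE => /orP[/eqP->//|/gl].
have [a Sa ab] : exists2 a, S a & beta a e != beta a b.
  apply: contrapT => H; apply: neb => a Sa; apply: contrapT => /eqP ab.
  by apply: H; exists a.
have ab0 : beta a b - beta a e != 0 by rewrite subr_eq0 eq_sym.
exists ((beta a b - beta a e)^-1 *: (monom_conj a g - beta a e *: g)); split.
- by apply: idealZ => //; apply: right_idealB => //; [exact: IS|exact: idealZ].
- move=> s bs; rewrite qcoefZ qcoefB qcoefZ /= (gb _ bs) (bs a Sa); field.
  exact: ab0.
- move=> s; rewrite inE qcoefZ qcoefB qcoefZ /= => /orP[/eqP-> _|sl bs].
    by rewrite [_ * beta _ _]mulrC subrr mulr0.
  by rewrite (gl _ sl bs) mul0r mulr0 subrr mulr0.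
Qed.

(** Up to any truncation, [f] agrees with the sum of finitely many of its isotypic parts. *)
Lemma isotypic_proj_ex (I : set R) f : right_ideal I ->
  (forall b, I (isotypic_proj b f)) -> I f.
Proof.
move=> Ir If; apply: (right_ideal_closed Ir) => N; have [I0 ID _] := Ir.
have [l lN] := rk_initial_finite n N.
suff [g Ig gl] : exists2 g, I g &
    forall s, qcoef g s = if has (fun e => `[< twist_sim e s >]) l then qcoef f s else 0.
  exists g => // s /lN sl; rewrite qcoefB gl.
  suff -> : has (fun e => `[< twist_sim e s >]) l by rewrite subrr.
  by apply/hasP; exists s => //; apply/asboolP.
elim: l {N lN} => [|e l [g Ig gl]]; first by exists 0.
(* If the class of [e] has already been met, its part must not be added a second time. *)
have [/hasP[d dl /asboolP de]|nel] := boolP (has (fun d => `[< twist_sim d e >]) l).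
  exists g => // s; rewrite gl /=; case: asboolP => //= es.
  suff -> : has (fun e => `[< twist_sim e s >]) l by [].
  by apply/hasP; exists d => //; apply/asboolP => a Sa; rewrite es ?de.
exists (g + isotypic_proj e f); first exact: ID.
move=> s; rewrite qcoefD gl /=; case: asboolP => /= es; last by rewrite addr0.
case: hasP => [[d dl /asboolP ds]|]; last by rewrite add0r.
case/hasP: nel; exists d => //; apply/asboolP => a Sa.
by rewrite -es ?ds.
Qed.

End Isotypic.

(** Some isotypic part of an [f] in [I] lies outside [P]. It need not be in [I], but it is in the
    saturation [Isat], which is stable under the conjugations; multiplying it by a suitable [X a],
    regular modulo [P], brings it into [I] and keeps it outside [P]. *)
Lemma normal_elements (P I : set R) : prime_ideal P -> ideal I -> ~ I `<=` P ->
  exists y, [/\ I y, ~ P y & normal_mod P y].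
Proof.
move=> Pp [Ir IL] nIP; have [Pi _ _] := Pp; have [Pr PL] := Pi; have [I0 ID IM] := Ir.
pose S : set (expo n) := [set a | ~ P (X a)].
have S0 : S 0 by exact: prime_not1.
pose Isat : set R := [set r | exists2 a, S a & I (r * X a)].
have satD r a b : S b -> I (r * X a) -> I (r * X (a + b)).
  move=> Sb Ira; have := idealZ (qtwist q a b)^-1 Ir (IM _ (X b) Ira).
  rewrite -mulrA qps_monomM -scalerAr scalerA mulVf ?scale1r //.
  exact: qtwist_neq0.
have Isatr : right_ideal Isat.
  split=> [|r s [a Sa Ir'] [b Sb Is]|r s [a Sa Ira]].
  - by exists 0; rewrite ?mul0r.
  - exists (a + b); first exact: prime_monomD.
    by rewrite mulrDl; apply: ID; [apply: satD|rewrite [a + b]addrC; apply: satD].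
  - by exists a => //; rewrite -mulrA monom_conjVE mulrA; apply: IM.
have IsatS a r : S a -> Isat r -> Isat (monom_conj a r).
  move=> Sa [b Sb Irb]; exists (a + b); first exact: prime_monomD.
  have := idealZ (qtwist q a b)^-1 Ir (IL (X a) _ Irb).
  rewrite mulrA -monom_conjE -mulrA qps_monomM -scalerAr scalerA mulVf ?scale1r //.
  exact: qtwist_neq0.
have [f If nPf] : exists2 f, I f & ~ P f.
  by apply: contrapT => H; apply: nIP => f If; apply: contrapT => Pf; apply: H; exists f.
have [b nPb] : exists b, ~ P (isotypic_proj S b f).
  apply: contrapT => H; apply: nPf; apply: (isotypic_proj_ex (S := S) Pr) => b.
  by apply: contrapT => Pb; apply: H; exists b.
have [a Sa Iy] : Isat (isotypic_proj S b f).
  apply: isotypic_proj_mem => //; exists 0 => //.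
  exact: IM.
exists (isotypic_proj S b f * X a); split=> //.
  by move=> /(proj2 (monom_regular Pp Sa _)).
(* Multiplication by [X a] shifts the class of [b] to that of [b + a]. *)
apply: (@twist_homog_normal S P (b + a)) => // [t /contrapT//|s].
have [|/qcoef_monomr0->] := boolP (expo_dvd a s); last by rewrite eqxx.
case/expo_dvdP=> t ->; rewrite addrC qcoef_monomr /=.
case: asboolP => [bt _ c Sc|]; last by rewrite mul0r eqxx.
by rewrite !betaDr (bt _ Sc).
Qed.

Lemma qps_normal_separation : normal_separation R.
Proof.
move=> P Q [Pi _ _] Qp [_ nPQ].
by have [y [Py nQy yN]] := normal_elements Qp Pi nPQ; exists y.
Qed.

Lemma qps_normally_separated : normally_separated R.
Proof.
move=> P0 P1 P01; have [P0i _ _] := spec_prime P0.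
have [y [P1y nP0y yN]] := qps_normal_separation (spec_prime P1) (spec_prime P0) P01.
by exists y => //; apply: normal_mod_sets.
Qed.

(** * Links, cliques and Goldie rank *)

Lemma link_conj (P Q : set R) : prime_ideal P -> prime_ideal Q -> link P Q ->
  exists2 t : R -> R, qconj_group t & t @` P = Q.
Proof.
move=> Pp Qp [J [Ji PQJ JPQ Jl Jr]]; have [[Pr PL] _ _] := Pp; have [[Qr QL] _ _] := Qp.
have lnk := link_normal Pp Qp Ji PQJ JPQ Jl Jr; have [[J0 JD JM] JL] := Ji.
have JPM := ideal_mulM PQJ.
have PQX a : P (X a) <-> Q (X a) by apply/lnk/monom_normal.
have [[a [Pa nJa]]|nJ] := pselect (exists a, P (X a) /\ ~ J (X a)).
  have Qa : Q (X a) by apply/PQX.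
  (* If [r * X a] is in [J] with [r] outside [P], [normal_elements] gives such an element [y] that
     is moreover regular modulo [P]; torsionfreeness then forces [X a] into [J]. The argument for
     [QE] is its mirror image. *)
  have PE r : P r <-> J (r * X a).
    split=> [Pr'|Jra]; first exact: JPM.
    apply: contrapT => nPr.
    have [||y [Jya nPy yN]] := @normal_elements P [set r | J (r * X a)] Pp.
    - split; first split=> [|r1 r2 h1 h2|r1 r2 h1] /=.
      + by rewrite mul0r.
      + by rewrite mulrDl; apply: JD.
      + by rewrite -mulrA monom_conjVE mulrA; apply: JM.
      + by move=> r1 r2 h2 /=; rewrite -mulrA; apply: JL.
    - by move/(_ r Jra).
    by apply: nJa; apply: (Jl y) => //; apply: normal_regular.
  have QE r : Q r <-> J (X a * r).
    split=> [Qr'|Jar]; first exact: JPM.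
    apply: contrapT => nQr.
    have [||y [Jay nQy yN]] := @normal_elements Q [set r | J (X a * r)] Qp.
    - split; first split=> [|r1 r2 h1 h2|r1 r2 h1] /=.
      + by rewrite mulr0.
      + by rewrite mulrDr; apply: JD.
      + by rewrite mulrA; apply: JM.
      + by move=> r1 r2 h2 /=; rewrite mulrA -monom_conjE -mulrA; apply: JL.
    - by move/(_ r Jar).
    by apply: nJa; apply: (Jr y) => //; apply: normal_regular.
  exists (monom_conjV a).
    exact: QConj_inv (monom_conj_group a) (monom_conjK a) (monom_conjVK a).
  apply/seteqP; split=> [_ [r Pr' <-]|r Qr'].
    by apply/QE; rewrite -monom_conjVE; apply/PE.
  exists (monom_conj a r); last exact: monom_conjK.
  by apply/PE; rewrite monom_conjE; apply/QE.
(* Now every monomial of [P] lies in [J], so isotypic parts for the remaining monomials are normal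
   modulo [J] and [lnk] applies to them. *)
pose S : set (expo n) := [set a | ~ P (X a)].
have SJ t : ~ S t -> J (X t).
  by move=> /contrapT Pt; apply: contrapT => Jt; apply: nJ; exists t.
have projN b f : normal_mod J (isotypic_proj S b f).
  apply: (twist_homog_normal Ji SJ (b := b)) => s /=.
  by case: asboolP => //; rewrite eqxx.
exists id; first exact: QConj_id.
rewrite image_id; apply/seteqP; split=> f.
  move=> Pf; apply: (isotypic_proj_ex (S := S) Qr) => b; apply/lnk => //.
  by apply: isotypic_proj_mem => // a r Sa; apply: prime_conj_stable.
(* Stability of [Q] under these conjugations holds because [P] and [Q] contain the same
   monomials. *)
move=> Qf; apply: (isotypic_proj_ex (S := S) Pr) => b; apply/lnk => //.
apply: isotypic_proj_mem => // a r Sa; apply: prime_conj_stable => //.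
by move/PQX.
Qed.

Lemma goldie_rank_conj (t : R -> R) (P Q : set R) d :
  qconj_group t -> t @` P = Q -> goldie_rank P d <-> goldie_rank Q d.
Proof.
move=> tG tPQ; have [tlin [_ tM] [u tK uK]] := qconj_group_aut hq tG.
have [ulin [_ uM] _] := qconj_group_aut hq (QConj_inv tG tK uK).
have addE (v : R -> R) : linear v -> {morph v : f g / f + g}.
  by move=> vlin f g; have := vlin 1 f g; rewrite !scale1r.
have QE : Q = [set f | P (u f)].
  rewrite -tPQ; apply/seteqP; split=> [_ [f Pf <-]|f Pf] /=; first by rewrite tK.
  by exists (u f).
have PE : P = [set f | Q (t f)] by rewrite QE; apply/seteqP; split=> f /=; rewrite tK.
have E e : indep_right_ideals P e <-> indep_right_ideals Q e.
  split; first by rewrite QE; apply: indep_right_ideals_transport tK uK (addE _ ulin) uM.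
  by rewrite [in X in _ -> X]PE; apply: indep_right_ideals_transport uK tK (addE _ tlin) tM.
by split=> -[/E dP dmax]; split=> // e /E; apply: dmax.
Qed.

(** The rank exists at the base point of the clique and is carried along each link by
    [goldie_rank_conj]. *)
Lemma clique_goldie_rank (Z : set (Spec R)) (P P' : Spec R) : clique Z -> Z P -> Z P' ->
  exists d, goldie_rank P d /\ goldie_rank P' d.
Proof.
move=> [P0 ->] /= P0P P0P'.
have E (P1 P2 : Spec R) d : clos_refl_sym_trans _ (fun P1 P2 : Spec R => link P1 P2) P1 P2 ->
    goldie_rank P1 d <-> goldie_rank P2 d.
  elim=> {P1 P2} [P1 P2 l12|//|P1 P2 _ ->//|P1 P2 P3 _ -> _ ->//].
  have [t tG tP] := link_conj (spec_prime P1) (spec_prime P2) l12.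
  exact: goldie_rank_conj tG tP.
have [[P0r _] _ _] := spec_prime P0.
have [d dP] := goldie_rank_exists qps_right_noetherian P0r.
by exists d; split; [apply/(E _ _ d P0P)|apply/(E _ _ d P0P')].
Qed.

End QSeries.

Theorem theorem4p5 (k : fieldType) (n : nat) (q : 'M[k]_n)
    (n_ge1 : (1 <= n)%N) (hq : mult_antisym q) :
  (normally_separated (qpseries q) /\ strong_second_layer (qpseries q)) /\
  ((forall P Q : Spec (qpseries q), link P Q ->
      exists2 t : qpseries q -> qpseries q, qconj_group t & t @` P = Q) /\
   (forall X : set (Spec (qpseries q)), clique X ->
      forall P P' : Spec (qpseries q), X P -> X P' ->
        exists d : nat, goldie_rank P d /\ goldie_rank P' d)).
Proof.
split; split.
- exact: qps_normally_separated.
- apply: noetherian_strong_second_layer; [exact: qps_right_noetherian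
    |exact: qps_left_noetherian|exact: qps_normal_separation].
- by move=> P Q; apply: link_conj => //; apply: spec_prime.
- by move=> X cX P P' XP XP'; apply: clique_goldie_rank cX XP XP'.
Qed.
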